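(* Let $k\geq 3$ be a fixed integer and let $p=p(n)$ satisfy $p\geq \frac{\log^{5k}n}{n^{k-1}}$. Then there is a function $\varepsilon(n)\to 0$ such that, with probability tending to $1$ as $n\to\infty$, the random hypergraph $H^k_{kn,p}$ contains at least $(1-\varepsilon(n))\binom{kn-1}{k-1}p$ pairwise edge-disjoint perfect matchings.
   Context: For $p\in[0,1]$ and integers $k,N$, $H^k_{N,p}$ denotes the binomial random $k$-uniform hypergraph on vertex set $[N]=\{1,\dots,N\}$ in which each $k$-subset of $[N]$ is an edge independently with probability $p$. A perfect matching is a set of pairwise vertex-disjoint edges covering all vertices. *)

(* Defs.v *)
From mathcomp Require Import all_boot all_order all_algebra.
From mathcomp Require Import reals.
Set Implicit Arguments.
Unset Strict Implicit.
Unset Printing Implicit Defensive.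
Import Order.TTheory GRing.Theory Num.Theory.
Local Open Scope ring_scope.

(* A hypergraph on the finite vertex type V is identified with its edge set
   H : {set {set V}}; it is k-uniform when H \subset ksubsets V k. *)
Definition ksubsets (V : finType) (k : nat) : {set {set V}} :=
  [set e : {set V} | #|e| == k].

Definition perfect_matching (V : finType) (H M : {set {set V}}) : bool :=
  [&& M \subset H, trivIset M & cover M == [set: V]].

Definition has_edge_disjoint_pms (R : realType) (V : finType)
    (H : {set {set V}}) (x : R) : bool :=
  [exists F : {set {set {set V}}},
    [&& [forall M in F, perfect_matching H M],
        [forall M1 in F, forall M2 in F, (M1 != M2) ==> [disjoint M1 & M2]]
      & x <= #|F|%:R]].

(* The vertex set [N] = {1, ..., N} is rendered as 'I_N = {0, ..., N - 1}. *)
Definition binom_weight (R : realType) (k N : nat) (p : R)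
    (H : {set {set 'I_N}}) : R :=
  \prod_(e in ksubsets 'I_N k) (if e \in H then p else 1 - p).

Definition binom_Pr (R : realType) (k N : nat) (p : R)
    (E : pred {set {set 'I_N}}) : R :=
  \sum_(H in powerset (ksubsets 'I_N k) | E H) binom_weight k p H.

Lemma binom_Pr_total (R : realType) (k N : nat) (p : R) :
  binom_Pr k p (xpredT : pred {set {set 'I_N}}) = 1.
Proof.
rewrite /binom_Pr /binom_weight.
set K := ksubsets _ _.
pose f (e : {set 'I_N}) : R := if e \in K then p else 0.
pose g (e : {set 'I_N}) : R := if e \in K then 1 - p else 1.
transitivity (\prod_(e : {set 'I_N}) (f e + g e)); last first.
  rewrite big1 // => e _; rewrite /f /g; case: ifP => _; last by rewrite add0r.
  by rewrite addrC subrK.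
rewrite bigA_distr [RHS](bigID (fun H => H \in powerset K)) /=.
rewrite [X in _ = _ + X]big1 ?addr0; last first.
  move=> H; rewrite powersetE => /subsetPn[e eH eK].
  by rewrite (bigD1 e) //= eH /f (negPf eK) mul0r.
apply: eq_big => [H|H]; first by rewrite andbT.
rewrite andbT powersetE => HK.
rewrite [RHS](bigID (mem K)) /= [X in _ = _ * X]big1 ?mulr1.
  by apply: eq_bigr => e eK; rewrite /f /g eK.
by move=> e eK; rewrite /f /g (negPf eK) (contraNF (subsetP HK e)).
Qed.

(* Main.v *)
(** Online sprinkling.  Let l = log n, D = 'C(kn-1, k-1), and let nu be the
    maximum number of edge-disjoint perfect matchings.  Edge probabilities are
    treated as a budget that is spent gradually.  In one round, starting from
    U = V, a small probability is spent repeatedly on all k-subsets of the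
    current vertex set U; when an edge appears, it is kept and its vertices are
    removed from U.  Since a single success suffices at each step, almost nothing
    is wasted: by the time |U| = k w with w ~ n / l^4, the expected budget spent
    at each edge is about 1/D.  The remaining vertices are matched by spending
    O(l^3 / w^(k-1)) at once on all k-subsets of U, which is negligible on average
    and suffices by the spread lemma (Alweiss-Lovett-Wu-Zhang,
    Frankston-Kahn-Narayanan-Park), because random perfect matchings are
    O(1/w^(k-1))-spread.  Repeating (1 - o(1)) D p independent rounds, a Chernoff
    bound shows that no edge exceeds its budget p, and a first moment bound shows
    that two rounds rarely share an edge when p is polylog / n^(k-1).  Hence the
    mean of nu is at least (1 - o(1)) D p for such p, and for all larger p since the
    mean is superadditive in p.  As nu <= |H| / n, and |H| / n is concentrated
    around D p, Markov's inequality turns this into a bound with probability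
    1 - o(1). *)
Require Import Defs.
From mathcomp Require Import all_boot all_order all_algebra.
From mathcomp Require Import reals ring lra zify.
Set Implicit Arguments.
Unset Strict Implicit.
Unset Printing Implicit Defensive.
Import Order.TTheory GRing.Theory Num.Theory.
Local Open Scope ring_scope.

(** * Product measures on edge sets *)

Section ProductMeasure.
Variables (R : realFieldType) (T : finType).
Implicit Types (p q r : T -> R) (f g : {set T} -> R) (A B C Q : {set T}) (e : T).

(** Densities vary from edge to edge because the budget left at an edge depends on the edge. *)
Definition wt p A : R := \prod_e (if e \in A then p e else 1 - p e).
Definition Ex p f : R := \sum_(A : {set T}) wt p A * f A.
Definition unit_valued p := forall e, 0 <= p e <= 1.
Definition set_mono f := forall A B, A \subset B -> f A <= f B.
Definition cst_on (Q : {set T}) (c : R) : T -> R := fun e => if e \in Q then c else 0.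

Lemma cst_on_unit_valued Q c : 0 <= c <= 1 -> unit_valued (cst_on Q c).
Proof. by move=> hc e; rewrite /cst_on; case: ifP => // _; rewrite lexx ler01. Qed.

Lemma wt_ge0 p A : unit_valued p -> 0 <= wt p A.
Proof.
move=> hp; apply: prodr_ge0 => e _; have /andP[h0 h1] := hp e.
by case: ifP => // _; rewrite subr_ge0.
Qed.

Lemma eq_Ex p f g : f =1 g -> Ex p f = Ex p g.
Proof. by move=> h; apply: eq_bigr => A _; rewrite h. Qed.

Lemma eq_Exp p q f : p =1 q -> Ex p f = Ex q f.
Proof.
move=> h; apply: eq_bigr => A _; congr (_ * _).
by apply: eq_bigr => e _; rewrite h.
Qed.

(** Independence of the edges, which algebraically is the expansion of a product of sums. *)
Lemma Ex_prod p (a b : T -> R) :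
  Ex p (fun A => \prod_e (if e \in A then a e else b e)) =
  \prod_e (p e * a e + (1 - p e) * b e).
Proof.
rewrite bigA_distr; apply: eq_bigr => A _.
rewrite /wt -big_split; apply: eq_bigr => e _ /=.
by case: ifP.
Qed.

Lemma Ex_add p f g : Ex p (fun A => f A + g A) = Ex p f + Ex p g.
Proof. by rewrite -big_split; apply: eq_bigr => A _; rewrite mulrDr. Qed.

Lemma Ex_scale p c f : Ex p (fun A => c * f A) = c * Ex p f.
Proof. by rewrite mulr_sumr; apply: eq_bigr => A _; rewrite mulrCA. Qed.

Lemma Ex_sum p (I : Type) (s : seq I) (P : pred I) (F : I -> {set T} -> R) :
  Ex p (fun A => \sum_(i <- s | P i) F i A) = \sum_(i <- s | P i) Ex p (F i).
Proof.
rewrite exchange_big /=; apply: eq_bigr => A _.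
by rewrite mulr_sumr.
Qed.

Lemma Ex_cst p c : Ex p (fun=> c) = c.
Proof.
rewrite -[X in Ex p X]/(fun=> c) -[RHS]mulr1.
transitivity (c * Ex p (fun A => \prod_e (if e \in A then 1 else 1))).
  rewrite -Ex_scale; apply: eq_Ex => A.
  by rewrite big1 ?mulr1 // => e _; case: ifP.
by rewrite Ex_prod big1 // => e _; rewrite !mulr1 addrC subrK.
Qed.

Lemma Ex_sub p f g : Ex p (fun A => f A - g A) = Ex p f - Ex p g.
Proof.
rewrite -[- Ex p g]mulN1r -Ex_scale -Ex_add; apply: eq_Ex => A.
by rewrite mulN1r.
Qed.

Lemma le_Ex p f g : unit_valued p -> (forall A, f A <= g A) -> Ex p f <= Ex p g.
Proof. by move=> hp h; apply: ler_sum => A _; apply: ler_wpM2l; [apply: wt_ge0|apply: h]. Qed.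

Lemma Ex_ge0 p f : unit_valued p -> (forall A, 0 <= f A) -> 0 <= Ex p f.
Proof. by move=> hp h; rewrite -(Ex_cst p 0); apply: le_Ex. Qed.

Lemma wt_supp p A e : p e = 0 -> e \in A -> wt p A = 0.
Proof. by move=> h he; rewrite /wt (bigD1 e) //= he h mul0r. Qed.

Lemma le_Ex_on Q c f g : 0 <= c <= 1 -> (forall A, A \subset Q -> f A <= g A) ->
  Ex (cst_on Q c) f <= Ex (cst_on Q c) g.
Proof.
move=> hc h; apply: ler_sum => A _; have [/h|/subsetPn[e eA eQ]] := boolP (A \subset Q).
  by apply: ler_wpM2l; apply: wt_ge0; apply: cst_on_unit_valued.
by rewrite (@wt_supp _ _ e) ?mul0r // /cst_on (negbTE eQ).
Qed.

(** Expanding [f] into point indicators leaves only products over edges, so [Ex_prod] reduces the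
    claim to one edge at a time. *)
Lemma Ex_op (op : bool -> bool -> bool) p q r f :
  (forall e, r e = p e * (q e * (op true true)%:R + (1 - q e) * (op true false)%:R)
     + (1 - p e) * (q e * (op false true)%:R + (1 - q e) * (op false false)%:R)) ->
  Ex p (fun A => Ex q (fun B => f [set e | op (e \in A) (e \in B)])) = Ex r f.
Proof.
move=> hr.
pose ind C A B : R := \prod_e ((e \in C) == op (e \in A) (e \in B))%:R.
have fE A B : f [set e | op (e \in A) (e \in B)] = \sum_C f C * ind C A B.
  rewrite (bigD1 [set e | op (e \in A) (e \in B)]) //= big1 => [|C hC].
    by rewrite addr0 /ind big1 ?mulr1 // => e _; rewrite inE eqxx.
  suff [e he] : exists e, (e \in C) != op (e \in A) (e \in B).
    by rewrite /ind (bigD1 e) //= (negbTE he) mul0r mulr0.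
  apply/existsP; apply: contraNT hC => /existsPn h.
  by apply/eqP/setP => e; rewrite inE; apply/eqP; rewrite -[_ == _]negbK.
transitivity (\sum_C f C * Ex p (fun A => Ex q (fun B => ind C A B))).
  under eq_Ex => A do under eq_Ex => B do rewrite fE.
  under eq_Ex => A do rewrite Ex_sum.
  rewrite Ex_sum; apply: eq_bigr => C _.
  by rewrite -Ex_scale; apply: eq_Ex => A; rewrite Ex_scale.
apply: eq_bigr => C _; rewrite mulrC; congr (_ * _).
pose c e b : R := q e * ((e \in C) == op b true)%:R + (1 - q e) * ((e \in C) == op b false)%:R.
transitivity (Ex p (fun A => \prod_e (if e \in A then c e true else c e false))).
  apply: eq_Ex => A.
  transitivity (Ex q (fun B => \prod_e (if e \in B then ((e \in C) == op (e \in A) true)%:R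
       else ((e \in C) == op (e \in A) false)%:R))).
    by apply: eq_Ex => B; apply: eq_bigr => e _; case: (e \in B).
  by rewrite Ex_prod; apply: eq_bigr => e _; rewrite /c; case: (e \in A).
rewrite Ex_prod; apply: eq_bigr => e _; rewrite /c hr.
by case: (e \in C); case: (op true true); case: (op true false); case: (op false true);
  case: (op false false) => /=; ring.
Qed.

Lemma Ex_setU p q f :
  Ex p (fun A => Ex q (fun B => f (A :|: B))) = Ex (fun e => p e + q e - p e * q e) f.
Proof.
rewrite -(@Ex_op orb p q (fun e => p e + q e - p e * q e) f) => [|e]; last by rewrite /= ?mulr1n ?mulr0n; ring.
by apply: eq_Ex => A; apply: eq_Ex => B; congr (f _); apply/setP => e; rewrite !inE.
Qed.

Lemma Ex_setI p q f :
  Ex p (fun A => Ex q (fun B => f (A :&: B))) = Ex (fun e => p e * q e) f.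
Proof.
rewrite -(@Ex_op andb p q (fun e => p e * q e) f) => [|e]; last by rewrite /= ?mulr1n ?mulr0n; ring.
by apply: eq_Ex => A; apply: eq_Ex => B; congr (f _); apply/setP => e; rewrite !inE.
Qed.

Lemma Ex_setD p q f :
  Ex p (fun A => Ex q (fun B => f (A :\: B))) = Ex (fun e => p e * (1 - q e)) f.
Proof.
rewrite -(@Ex_op (fun a b => ~~ b && a) p q (fun e => p e * (1 - q e)) f) => [|e]; last by rewrite /= ?mulr1n ?mulr0n; ring.
by apply: eq_Ex => A; apply: eq_Ex => B; congr (f _); apply/setP => e; rewrite !inE.
Qed.

(** Monotone coupling: a set of density [q] is the union of a set of density [p] and an independent
    set of density [r]. *)
Lemma Ex_mono p q f : unit_valued p -> unit_valued q -> (forall e, p e <= q e) -> set_mono f ->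
  Ex p f <= Ex q f.
Proof.
move=> hp hq hpq hf.
(* Solves [p + r - p * r = q]. Where [p e = 1] the quotient is 0 by convention, which is right
   because then [q e = 1] too. *)
pose r e := (q e - p e) / (1 - p e).
have hr : unit_valued r.
  move=> e; rewrite /r; have := hpq e; have := hp e; have := hq e => /andP[q0 q1] /andP[p0 p1] pq.
  have [->|p1'] := eqVneq (p e) 1; first by rewrite subrr invr0 mulr0 lexx ler01.
  have d0 : 0 < 1 - p e by rewrite subr_gt0 lt_neqAle p1'.
  by rewrite divr_ge0 ?subr_ge0 //= ler_pdivrMr // mul1r lerD2r.
rewrite -(@eq_Exp (fun e => p e + r e - p e * r e) q f) => [|e]; last first.
  have := hpq e; have := hp e; have := hq e => /andP[q0 q1] /andP[p0 p1] pq.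
  rewrite /r; have [p1'|p1'] := eqVneq (p e) 1.
    by rewrite p1' subrr invr0 !mulr0; lra.
  have d0 : 1 - p e != 0 by rewrite subr_eq0 eq_sym.
  by field.
rewrite -Ex_setU; apply: le_Ex => // A.
by rewrite -{1}(Ex_cst r (f A)); apply: le_Ex => // B; apply: hf; apply: subsetUl.
Qed.

Lemma Ex_sprinkle p q r f : unit_valued p -> unit_valued q -> unit_valued r ->
  (forall e, q e + r e <= p e) -> set_mono f ->
  Ex r (fun B => Ex q (fun A => f (A :|: B))) <= Ex p f.
Proof.
move=> hp hq hr h hf.
under eq_Ex => B do under eq_Ex => A do rewrite setUC.
rewrite Ex_setU; apply: Ex_mono => // e; have /andP[q0 q1] := hq e; have /andP[r0 r1] := hr e.
  apply/andP; split; nra.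
by have := h e; nra.
Qed.

Lemma Ex_in p e : Ex p (fun A => (e \in A)%:R) = p e.
Proof.
transitivity (Ex p (fun A => \prod_e' (if e' \in A then 1 else (e' != e)%:R))).
  apply: eq_Ex => A; rewrite (bigD1 e) //= eqxx big1 => [|e' h]; last by rewrite h; case: ifP.
  by rewrite mulr1; case: ifP.
rewrite Ex_prod (bigD1 e) //= eqxx big1 => [|e' h]; last by rewrite h mulr1n; ring.
by rewrite mulr0n; ring.
Qed.

Lemma Ex_in2 p e e' : e != e' -> Ex p (fun A => (e \in A)%:R * (e' \in A)%:R) = p e * p e'.
Proof.
move=> hee.
transitivity (Ex p (fun A => \prod_x (if x \in A then 1 else (x \notin [set e; e'])%:R))).
  apply: eq_Ex => A; rewrite (bigD1 e) //= (bigD1 e') 1?eq_sym //= big1 => [|x /andP[h h']].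
    by rewrite !inE !eqxx orbT mulr1; do 2 case: ifP.
  by rewrite !inE (negbTE h) (negbTE h'); case: ifP.
rewrite Ex_prod (bigD1 e) //= (bigD1 e') 1?eq_sym //= big1 => [|x /andP[h h']].
  by rewrite !inE !eqxx orbT /= mulr0n; ring.
by rewrite !inE (negbTE h) (negbTE h') /= mulr1n; ring.
Qed.

Lemma wt_set1 Q c e : e \in Q -> wt (cst_on Q c) [set e] = c * (1 - c) ^+ #|Q|.-1.
Proof.
move=> he; rewrite /wt (bigD1 e) //= inE eqxx /cst_on he; congr (_ * _).
rewrite (cardsD1 e) he /= -prodr_const [RHS]big_mkcond /= big_mkcond /=.
apply: eq_bigr => x _; rewrite !inE; case: eqVneq => //= _.
by case: ifP => // _; rewrite subr0.
Qed.

Lemma bernoulli (x : R) n : 0 <= x <= 1 -> 1 - n%:R * x <= (1 - x) ^+ n.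
Proof.
move=> /andP[x0 x1]; elim: n => [|n IH]; first by rewrite expr0 mul0r subr0.
rewrite exprS; have := ler_wpM2l _ IH; have : 0 <= 1 - x by lra.
move=> h /(_ _ h) h'; apply: le_trans h'; rewrite -addn1 natrD.
have : 0 <= n%:R * x * x by rewrite !mulr_ge0.
by nra.
Qed.

Lemma one_step Q c s g : 0 <= c <= 1 ->
  (0 < #|Q|)%N -> s / #|Q|%:R <= c * (1 - #|Q|%:R * c) -> set_mono g ->
  (1 - s) * g set0 + s / #|Q|%:R * (\sum_(e in Q) g [set e]) <= Ex (cst_on Q c) g.
Proof.
move=> hc hQ hsc hg.
(* Only the events that the random set is empty or a singleton are used. *)
have hp := cst_on_unit_valued Q hc.
have Q0 : #|Q|%:R != 0 :> R by rewrite pnatr_eq0 -lt0n.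
apply: (@le_trans _ _ (Ex (cst_on Q c) (fun B => g set0 +
    \sum_(e in Q) (B == [set e])%:R * (g [set e] - g set0)))); last first.
  apply: le_Ex => // B.
  have [/existsP[e /andP[eQ /eqP->]]|/existsPn h] := boolP [exists e, (e \in Q) && (B == [set e])].
    rewrite (bigD1 e) //= eqxx mul1r big1 => [|e' /andP[_ h]].
      by rewrite addr0 addrC subrK.
    rewrite (_ : _ == _ = false) ?mul0r //; apply/negbTE; apply: contraNneq h.
    by move/set1_inj => ->.
  rewrite big1 ?addr0 ?hg ?sub0set // => e eQ.
  by have := h e; rewrite eQ /= => /negbTE ->; rewrite mul0r.
rewrite Ex_add Ex_cst Ex_sum.
have -> : (1 - s) * g set0 + s / #|Q|%:R * (\sum_(e in Q) g [set e]) =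
    g set0 + \sum_(e in Q) s / #|Q|%:R * (g [set e] - g set0).
  rewrite -mulr_sumr sumrB sumr_const -[g set0 *+ _]mulr_natr.
  by field.
rewrite lerD2l; apply: ler_sum => e eQ.
have -> : Ex (cst_on Q c) (fun A => (A == [set e])%:R * (g [set e] - g set0))
   = wt (cst_on Q c) [set e] * (g [set e] - g set0).
  rewrite /Ex (bigD1 [set e]) //= eqxx mul1r big1 ?addr0 // => A /negbTE ->.
  by rewrite mul0r mulr0.
apply: ler_wpM2r; first by rewrite subr_ge0 hg ?sub0set.
(* Bernoulli's inequality bounds the probability of a given singleton from below by
   [c * (1 - #|Q| * c)]. *)
rewrite wt_set1 //; apply: (le_trans hsc); apply: ler_wpM2l; first by case/andP: hc.
apply: le_trans (bernoulli _ hc).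
rewrite lerB // ler_wpM2r ?ler_nat ?leq_pred //; by case/andP: hc.
Qed.

End ProductMeasure.

(** * Spread families *)

Section Spread.
Variables (R : realFieldType) (T : finType).
Implicit Types (w : {set T} -> R) (A B S W Z Q : {set T}).

(** The total mass of [w] may be less than 1: the halving argument discards some mass at each
    step. *)
Definition spread (kappa : R) w :=
  forall A, \sum_(S : {set T} | A \subset S) w S <= kappa^-1 ^+ #|A|.

(** The minimum fragment of Park and Pham: what is left to cover once [W] is revealed, minimised
    over all members of the support inside [W :|: S]. *)
Definition fragment w W S : {set T} :=
  [arg min_(S' < S | (w S' != 0) && (S' \subset W :|: S)) #|S' :\: W|] :\: W.

Lemma fragmentP w W S : w S != 0 -> exists S',
  [/\ w S' != 0, S' \subset W :|: S, fragment w W S = S' :\: W &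
    forall S'', w S'' != 0 -> S'' \subset W :|: S -> (#|fragment w W S| <= #|S'' :\: W|)%N].
Proof.
move=> hS; rewrite /fragment; case: arg_minnP => [|S' /andP[h1 h2] h3].
  by rewrite hS subsetUr.
by exists S'; split=> // S'' h4 h5; apply: h3; rewrite h4.
Qed.

Lemma fragment_sub w W S : w S != 0 -> fragment w W S \subset S.
Proof. by case/(fragmentP W) => S' [_ h -> _]; rewrite subDset. Qed.

Lemma fragment_disjoint w W S : [disjoint W & fragment w W S].
Proof. by rewrite /fragment disjoint_sym -setI_eq0 setIDAC setDIl setDv setI0 //. Qed.

(** [Z :\: W] lies in the fragment of [S] and by minimality is no smaller, so the two are equal. *)
Lemma fragment_contained w W S Z : w S != 0 -> w Z != 0 -> Z \subset W :|: fragment w W S ->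
  fragment w W S \subset Z.
Proof.
move=> hS hZ hsub; have [S' [_ _ _ hmin]] := fragmentP W hS.
have h1 : Z :\: W \subset fragment w W S by rewrite subDset.
have h2 : Z \subset W :|: S by apply: (subset_trans hsub); rewrite setUS ?fragment_sub.
have /eqP <- : Z :\: W == fragment w W S by rewrite eqEcard h1 hmin.
exact: subsetDl.
Qed.

Lemma wt_setU (q : R) Q W A : 0 <= q <= 1 -> A \subset Q -> [disjoint W & A] ->
  wt (cst_on Q q) W * q ^+ #|A| <= wt (cst_on Q q) (W :|: A).
Proof.
move=> hq hA hWA; rewrite /wt (bigID (mem A)) [leRHS](bigID (mem A)) /=.
rewrite mulrAC; apply: ler_pM.
- rewrite mulr_ge0 ?exprn_ge0 //; last by case/andP: hq.
  by rewrite prodr_ge0 // => e _; have := cst_on_unit_valued Q hq e; case: ifP; lra.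
- by rewrite prodr_ge0 // => e _; have := cst_on_unit_valued Q hq e; case: ifP; lra.
- rewrite [leRHS](eq_bigr (fun=> q)) => [|e eA]; last first.
    by rewrite inE eA orbT /cst_on (subsetP hA).
  rewrite prodr_const ler_piMl ?exprn_ge0 //; first by lra.
  by apply: Num.Theory.prodr_ile1 => e _; have := cst_on_unit_valued Q hq e; case: ifP; lra.
apply: ler_prod => e /negbTE he; rewrite inE he orbF lexx andbT.
by have := cst_on_unit_valued Q hq e; case: ifP; lra.
Qed.

(** Substitution [Z = W :|: A], injective on the sets disjoint from [A]; adding [A] multiplies the
    weight by at least [q ^+ #|A|]. *)
Lemma Ex_shift (q : R) Q A (g : {set T} -> R) : 0 < q <= 1 -> A \subset Q ->
  (forall Z, 0 <= g Z) ->
  Ex (cst_on Q q) (fun W => [disjoint W & A]%:R * g (W :|: A)) <=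
  q^-1 ^+ #|A| * Ex (cst_on Q q) (fun Z => (A \subset Z)%:R * g Z).
Proof.
move=> /andP[q0 q1] hA hg.
have hq : 0 <= q <= 1 by rewrite ltW.
rewrite exprVn mulrC ler_pdivlMr ?exprn_gt0 // /Ex mulr_suml.
rewrite [leLHS](bigID (fun W => [disjoint W & A])) /= [X in _ + X]big1 ?addr0; last first.
  by move=> W /negbTE ->; rewrite mul0r mulr0 mul0r.
rewrite [leRHS](bigID (fun Z => A \subset Z)) /= [X in _ + X]big1 ?addr0; last first.
  by move=> W /negbTE ->; rewrite mul0r mulr0.
rewrite [leRHS](reindex_onto (fun W => W :|: A) (fun Z => Z :\: A)) /=; last first.
  move=> Z hZ; apply/setP => e; rewrite !inE.
  by have [/(subsetP hZ)->|_] := boolP (e \in A); rewrite ?orbF.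
rewrite [leRHS](eq_bigl (fun W => [disjoint W & A])) => [|W]; last first.
  rewrite subsetUr /= setDUl setDv setU0; apply/eqP/idP => [<-|/setDidPl //].
  by rewrite -setI_eq0 setIDAC setDIl setDv setI0.
apply: ler_sum => W hW; rewrite hW subsetUr !mul1r mulrAC.
by apply: ler_wpM2r => //; apply: wt_setU.
Qed.

Variables (Q : {set T}) (q kappa : R).
Hypotheses (hq : 0 < q <= 1) (hk : 0 < kappa).

(* Fragments of large size are rare: [A := fragment w W S] lies in [star (W :|: A)],
   which depends on [W :|: A] only, so given this union there are at most [2 ^ r]
   choices for [A]; passing from [W] to [W :|: A] costs [q^-1 ^+ #|A|], and by
   spreadness the sets [S] containing [A] have weight at most [kappa^-1 ^+ #|A|]. *)
Lemma fragment_loss w r h :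
  1 <= q * kappa -> (forall S, 0 <= w S) -> spread kappa w ->
  (forall S, w S != 0 -> (S \subset Q) && (#|S| <= r)%N) ->
  Ex (cst_on Q q) (fun W => \sum_(S : {set T} | (h < #|fragment w W S|)%N) w S) <=
   2 ^+ r / (q * kappa) ^+ h.+1.
Proof.
move=> hL w0 hspread hsupp.
have q0 : 0 < q by case/andP: hq.
pose star Z := odflt set0 [pick S | (w S != 0) && (S \subset Z)].
have star_r Z : (#|star Z| <= r)%N.
  rewrite /star; case: pickP => [S /andP[/hsupp/andP[_ //]]|_]; by rewrite /= cards0.
have hprob : unit_valued (cst_on Q q) by apply: cst_on_unit_valued; case/andP: hq => /ltW -> ->.
have bound W : \sum_(S : {set T} | (h < #|fragment w W S|)%N) w S <=
   \sum_(A : {set T} | (h < #|A|)%N && (A \subset Q)) kappa^-1 ^+ #|A| *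
      ([disjoint W & A]%:R * (A \subset star (W :|: A))%:R).
  rewrite (partition_big (fragment w W) (fun A => (h < #|A|)%N)) //=.
  rewrite [leLHS](bigID (fun A => A \subset Q)) /= [X in _ + X]big1 ?addr0; last first.
    move=> A /andP[_ hAQ]; rewrite big1 // => S /andP[_ /eqP hS]; apply/eqP.
    apply: contraNT hAQ => wS; rewrite -hS; apply: subset_trans (fragment_sub W wS) _.
    by case/andP: (hsupp _ wS).
  apply: ler_sum => A /andP[hA hAQ].
  have [/existsP[S /andP[wS /eqP fS]]|/existsPn hn] := boolP [exists S, (w S != 0) && (fragment w W S == A)].
    have -> : [disjoint W & A] by rewrite -fS fragment_disjoint.
    have -> : A \subset star (W :|: A).
      rewrite /star; case: pickP => [Z /andP[wZ hZ]|/=].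
        by rewrite -fS; apply: fragment_contained => //; rewrite fS.
      have [S' [h1 h2 h3 _]] := fragmentP W wS => /(_ S').
      by rewrite h1 -subDset -fS h3 subxx.
    rewrite !mulr1; apply: le_trans (hspread A).
    rewrite big_mkcond [leRHS]big_mkcond /=; apply: ler_sum => S1 _.
    case: ifP => [/andP[_ /eqP <-]|_]; last by case: ifP.
    by have [->|w1] := eqVneq (w S1) 0; [case: ifP|rewrite fragment_sub].
  rewrite big1 => [|S /andP[_ hS]]; last by have := hn S; rewrite hS andbT negbK => /eqP.
  by rewrite !mulr_ge0 ?exprn_ge0 ?invr_ge0 // ltW.
apply: (le_trans (le_Ex hprob bound)); rewrite Ex_sum.
apply: (@le_trans _ _ (\sum_(A : {set T} | (h < #|A|)%N && (A \subset Q))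
   (q * kappa)^-1 ^+ h.+1 * Ex (cst_on Q q) (fun Z => (A \subset star Z)%:R))).
  apply: ler_sum => A /andP[hA hAQ]; rewrite Ex_scale.
  apply: (@le_trans _ _ (kappa^-1 ^+ #|A| * (q^-1 ^+ #|A| *
      Ex (cst_on Q q) (fun Z => (A \subset Z)%:R * (A \subset star Z)%:R)))).
    apply: ler_wpM2l; first by rewrite exprn_ge0 // invr_ge0 ltW.
    by apply: (@Ex_shift _ _ _ (fun Z => (A \subset star Z)%:R)).
  rewrite mulrA -exprMn mulrC -invfM (mulrC kappa) [leRHS]mulrC; apply: ler_pM.
  - by apply: Ex_ge0 => // Z; rewrite mulr_ge0.
  - by rewrite exprn_ge0 // invr_ge0 mulr_ge0 // ltW.
  - by apply: le_Ex => // Z; case: (A \subset Z); rewrite ?mul1r // mul0r.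
  apply: ler_wiXn2l => //; first by rewrite invr_ge0 mulr_ge0 // ltW.
  by rewrite invf_le1 ?hL // (lt_le_trans _ hL).
rewrite -mulr_sumr mulrC -exprVn; apply: ler_wpM2r.
  by rewrite exprn_ge0 // invr_ge0 mulr_ge0 // ltW.
rewrite -Ex_sum -[leRHS](Ex_cst (cst_on Q q)); apply: le_Ex => // Z.
apply: (@le_trans _ _ (\sum_(A in powerset (star Z)) 1)).
  rewrite big_mkcond [leRHS]big_mkcond /=; apply: ler_sum => A _.
  by rewrite powersetE; case: ifP; case: (A \subset star Z).
rewrite sumr_const card_powerset natrX.
by apply: ler_weXn2l => //; rewrite ler1n.
Qed.

(* One more random set of density [q] halves the size of the sets still to be
   covered: the family of fragments of size less than [2 ^ j] inherits spreadness. *)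
Lemma spread_lemma j w :
  4 <= q * kappa -> (j%:R * q <= 1) -> (forall S, 0 <= w S) -> spread kappa w ->
  (forall S, w S != 0 -> (S \subset Q) && (#|S| < 2 ^ j)%N) ->
  \sum_S w S - j%:R * (4 / (q * kappa)) <=
  Ex (cst_on Q (j%:R * q)) (fun B => [exists S, (w S != 0) && (S \subset B)]%:R).
Proof.
move=> hL; have q0 : 0 < q by case/andP: hq.
have L0 : 0 < q * kappa by rewrite mulr_gt0.
elim: j w => [|j IH] w hj w0 hspread hsupp.
  (* Sets with fewer than one element: the support is empty or consists of [set0], and spreadness at
     [set0] bounds the total mass by 1. *)
  rewrite !mul0r subr0.
  have p0 : unit_valued (cst_on Q (0 : R)) by apply: cst_on_unit_valued; rewrite lexx ler01.
  have [/existsP[S wS]|/existsPn hn] := boolP [exists S, w S != 0]; last first.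
    rewrite big1 => [|S _]; last by apply/eqP; rewrite -[_ == _]negbK hn.
    by apply: Ex_ge0.
  have S0 : S = set0.
    by have /andP[_] := hsupp _ wS; rewrite expn0 ltnS leqn0 cards_eq0 => /eqP.
  have /= := hspread set0; rewrite cards0 expr0.
  rewrite (eq_bigl xpredT) => [|?]; last by rewrite sub0set.
  move/le_trans; apply; rewrite -[leLHS](Ex_cst (cst_on Q 0)); apply: le_Ex => // B.
  by rewrite (_ : [exists _, _]) //; apply/existsP; exists S; rewrite wS S0 sub0set.
pose h := (2 ^ j).-1.
have h1 : h.+1 = (2 ^ j)%N by rewrite prednK // expn_gt0.
(* The image of [w] under taking fragments, restricted to fragments of size at most [h]. Spreadness
   passes to it because a fragment lies in its set. *)
pose w' W A := \sum_(S | (fragment w W S == A) && (#|A| <= h)%N) w S.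
have w'0 W A : 0 <= w' W A by apply: sumr_ge0.
have w'P W A : w' W A != 0 -> exists S, [/\ w S != 0, fragment w W S = A & (#|A| <= h)%N].
  move=> hA; have : ~~ [forall S, (fragment w W S == A) && (#|A| <= h)%N ==> (w S == 0)].
    apply: contraNN hA => /forallP hS; apply/eqP/big1 => S hSA.
    by have := hS S; rewrite hSA => /eqP.
  case/forallPn => S; rewrite negb_imply => /andP[/andP[/eqP hS1 hS2] hS3].
  by exists S.
have jq1 : 0 <= j%:R * q <= 1.
  apply/andP; split; first by rewrite mulr_ge0 // ltW.
  by apply: le_trans hj; rewrite ler_pM2r // ler_nat.
have hp1 : unit_valued (cst_on Q (j.+1%:R * q)) by apply: cst_on_unit_valued; rewrite hj mulr_ge0 // ltW.
have hp2 : unit_valued (cst_on Q (j%:R * q)) by apply: cst_on_unit_valued.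
have hp3 : unit_valued (cst_on Q q) by apply: cst_on_unit_valued; case/andP: hq => /ltW -> ->.
pose f w B : R := [exists S, (w S != 0) && (S \subset B)]%:R.
have fmono v : set_mono (f v).
  move=> A B hAB; rewrite /f; case: existsP => [[S /andP[h2 h3]]|]; last by [].
  by rewrite (_ : [exists _, _]) //; apply/existsP; exists S; rewrite h2 (subset_trans h3).
have hsum e : cst_on Q (j%:R * q) e + cst_on Q q e <= cst_on Q (j.+1%:R * q) e.
  by rewrite /cst_on; case: ifP; rewrite ?addr0 // -natr1 mulrDl mul1r.
apply: le_trans (Ex_sprinkle hp1 hp2 hp3 hsum (fmono w)).
apply: (@le_trans _ _ (Ex (cst_on Q q) (fun W => \sum_A w' W A - j%:R * (4 / (q * kappa))))); last first.
  apply: le_Ex => // W.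
  apply: (@le_trans _ _ (Ex (cst_on Q (j%:R * q)) (f (w' W)))).
    apply: IH => //; first by case/andP: jq1.
    - move=> A; apply: le_trans (hspread A).
      rewrite /w' (exchange_big_dep xpredT) //= [leRHS]big_mkcond /=.
      apply: ler_sum => S _.
      have [->|wS] := eqVneq (w S) 0; first by rewrite big1 //; case: ifP.
      have [/andP[hA hB]|hn] := boolP ((A \subset fragment w W S) && (#|fragment w W S| <= h)%N).
        rewrite (big_pred1 (fragment w W S)) => [|B /=].
          by rewrite (subset_trans hA (fragment_sub _ wS)).
        by rewrite eq_sym; case: eqVneq => [->|]; rewrite ?andbF //= hA hB.
      rewrite big1 => [|B /andP[h2 /andP[/eqP h3 h4]]]; first by case: ifP.
      by rewrite h3 h2 h4 in hn.
    - move=> A /w'P[S [wS <- hA]]; have /andP[hSQ _] := hsupp _ wS.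
      by rewrite (subset_trans (fragment_sub _ wS)) // -h1 ltnS.
  apply: le_Ex => // B; rewrite /f.
  (* If [B] covers the fragment of [S], then [W :|: B] covers the minimiser [S'] that defines it,
     though perhaps not [S]. *)
  case: existsP => [[A /andP[/w'P[S [wS hA _]] hAB]]|]; last by [].
  have [S' [h2 h3 h4 _]] := fragmentP W wS.
  rewrite (_ : [exists _, _]) //; apply/existsP; exists S'; rewrite h2 /=.
  by rewrite setUC -subDset -h4 hA.
rewrite Ex_sub Ex_cst -natr1 mulrDl mul1r opprD addrA lerBlDr addrAC lerD2r.
have split W : \sum_A w' W A = \sum_S w S - \sum_(S | (h < #|fragment w W S|)%N) w S.
  rewrite [X in _ = X - _](bigID (fun S => (h < #|fragment w W S|)%N)) /= [X in _ = X - _]addrC addrK.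
  rewrite [RHS](partition_big (fragment w W) xpredT) //=; apply: eq_bigr => A _.
  apply: eq_bigl => S; rewrite -leqNgt andbC; case: eqVneq => [->|] //=; by rewrite ?andbT ?andbF.
under eq_Ex => W do rewrite split.
rewrite Ex_sub Ex_cst -addrA lerDl addrC subr_ge0 //.
have hr : forall S, w S != 0 -> (S \subset Q) && (#|S| <= (2 ^ j.+1))%N.
  by move=> S /hsupp/andP[-> /ltnW].
apply: le_trans (fragment_loss h _ w0 hspread hr) _; first by lra.
(* The loss is [(4 / (q * kappa)) ^+ (2 ^ j)], at most its base because the base is at most 1. *)
rewrite h1 expnS exprM -expr_div_n.
have d1 : (2 ^+ 2) / (q * kappa) <= 1 by rewrite ler_pdivrMr // mul1r expr2; lra.
have d0 : 0 <= (2 ^+ 2) / (q * kappa) by rewrite divr_ge0 ?exprn_ge0 ?ltW.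
rewrite (_ : 4 = 2 ^+ 2); last by rewrite expr2; ring.
by rewrite -[leRHS]expr1; apply: ler_wiXn2l; rewrite // expn_gt0.
Qed.

End Spread.

(** * Bounds for powers, falling factorials and binomials *)

(** The bound 4 ^ a for the central binomial bounds [a ^ a] by [4 ^ a] times the factorial of [a];
    the rest is the factorwise inequality [w * (a - i) <= a * (w - i)]. *)
Lemma leq_exp_ffact w a : (a <= w -> w ^ a <= 4 ^ a * w ^_ a)%N.
Proof.
move=> aw.
have expE x : (x ^ a = \prod_(i < a) x)%N by rewrite prod_nat_const card_ord.
have h1 : (a ^ a <= 4 ^ a * a`!)%N.
  have h : ('C(a + a, a) <= 4 ^ a)%N.
    rewrite (_ : 4 = 2 ^ 2)%N // -expnM mul2n -addnn -[X in (_ <= X ^ _)%N]/(1 + 1)%N.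
    rewrite expnDn (bigD1 (inord a)) //= inordK ?ltnS ?leq_addr //.
    by rewrite !exp1n !muln1 leq_addr.
  apply: leq_trans (leq_mul h (leqnn _)); rewrite bin_ffact ffact_prod.
  rewrite expE; apply: leq_prod => i _.
  by have := ltn_ord i; lia.
have h2 : (w ^ a * a`! <= a ^ a * w ^_ a)%N.
  rewrite -ffactnn !ffact_prod !expE -!big_split /=.
  apply: leq_prod => i _; rewrite !mulnBr [(a * w)%N]mulnC leq_sub2l //.
  by rewrite leq_mul2r aw orbT.
rewrite -(leq_pmul2r (fact_gt0 a)); apply: (leq_trans h2).
by rewrite mulnAC leq_mul2r h1 orbT.
Qed.

Lemma leq_exp_bin k u : (u ^ k <= 'C(k * u, k))%N.
Proof.
case: (posnP u) => [->|u0].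
  by case: k => [|k]; rewrite ?bin0 // exp0n.
rewrite -(leq_pmul2r (fact_gt0 k)) bin_ffact -ffactnn !ffact_prod.
have -> : (u ^ k = \prod_(i < k) u)%N by rewrite prod_nat_const card_ord.
rewrite -big_split /=.
by apply: leq_prod => i _; have := ltn_ord i; nia.
Qed.

(** * Perfect matchings in sparse random hypergraphs *)

Section Matchings.
Variables (R : realFieldType) (V : finType) (k : nat).
Hypothesis k0 : (0 < k)%N.
Implicit Types (U e : {set V}) (A B M S : {set {set V}}).

Definition edges_in U : {set {set V}} := [set e : {set V} | e \subset U & #|e| == k].

Definition is_pm U M := [&& M \subset edges_in U, trivIset M & cover M == U].

Definition has_pm U B := [exists M : {set {set V}}, is_pm U M && (M \subset B)].

Lemma card_edges_in U : #|edges_in U| = 'C(#|U|, k).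
Proof. exact: cards_draws. Qed.

Lemma card_edges_in_gt0 U u : #|U| = (k * u.+1)%N -> (0 < #|edges_in U|)%N.
Proof. by move=> hU; rewrite card_edges_in bin_gt0 hU leq_pmulr. Qed.

Lemma card_diff_edge U u e : #|U| = (k * u.+1)%N -> e \in edges_in U -> #|U :\: e| = (k * u)%N.
Proof.
move=> hU; rewrite inE => /andP[eU /eqP ek].
by rewrite cardsD (setIidPr eU) hU ek mulnS addKn.
Qed.

Lemma edges_inS U U' : U \subset U' -> edges_in U \subset edges_in U'.
Proof.
move=> hU; apply/subsetP => e; rewrite !inE => /andP[h ->].
by rewrite (subset_trans h).
Qed.

Lemma is_pm0 : is_pm set0 set0.
Proof. by rewrite /is_pm sub0set /trivIset /cover !big_set0 cards0 !eqxx. Qed.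

Lemma is_pmU1 U e M : e \in edges_in U -> is_pm (U :\: e) M -> is_pm U (e |: M).
Proof.
move=> he /and3P[h1 h2 /eqP h3]; apply/and3P.
have [eU ek] : e \subset U /\ #|e| = k by move: he; rewrite inE => /andP[-> /eqP].
split.
- rewrite subUset sub1set he /=; apply: subset_trans h1 _.
  by apply: edges_inS; apply: subsetDl.
- have [] // : trivIset (e |: M) /\ e \notin M.
  apply: trivIsetU1 => // [f fM|].
    have : f \subset U :\: e by rewrite -h3; apply: bigcup_sup.
    by rewrite subsetD disjoint_sym => /andP[].
  apply/negP => /(subsetP h1); rewrite inE cards0 => /andP[_ /eqP k00].
  by move: k0; rewrite -k00.
- rewrite /cover bigcup_setU big_set1 -/(cover M) h3.
  apply/eqP/setP => x; rewrite !inE.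
  by have [/(subsetP eU)->|_] := boolP (x \in e).
Qed.

(* [pmE u U F] is the mean of [F] over the random perfect matching of [U] obtained
   by removing, [u] times, a uniformly random edge from the remaining vertices. *)
Fixpoint pmE u U (F : {set {set V}} -> R) : R :=
  if u is u'.+1 then
    (\sum_(e in edges_in U) pmE u' (U :\: e) (fun M => F (e |: M))) / #|edges_in U|%:R
  else F set0.

Lemma pmE_mono u U F G : #|U| = (k * u)%N ->
  (forall M, is_pm U M -> F M <= G M) -> pmE u U F <= pmE u U G.
Proof.
elim: u U F G => [|u IH] U F G hU h /=.
  by move: hU; rewrite muln0 => /cards0_eq hU; apply: h; rewrite hU is_pm0.
apply: ler_wpM2r; first by rewrite invr_ge0.
apply: ler_sum => e he; apply: IH => [|M hM]; first exact: (card_diff_edge hU).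
by apply: h; apply: is_pmU1.
Qed.

Lemma pmE_sum u U (I : Type) (s : seq I) (P : pred I) (F : I -> {set {set V}} -> R) :
  pmE u U (fun M => \sum_(i <- s | P i) F i M) = \sum_(i <- s | P i) pmE u U (F i).
Proof.
elim: u U F => [|u IH] U F //=.
rewrite -mulr_suml exchange_big /=; congr (_ / _).
by apply: eq_bigr => e _; rewrite IH.
Qed.

Lemma pmE_cst u U c : #|U| = (k * u)%N -> pmE u U (fun=> c) = c.
Proof.
elim: u U => [|u IH] U hU //=.
rewrite (eq_bigr (fun=> c)) => [|e he]; last by rewrite IH //; apply: (card_diff_edge hU).
rewrite sumr_const -[c *+ _]mulr_natr mulfK // pnatr_eq0 -lt0n.
exact: card_edges_in_gt0 hU.
Qed.

Lemma eq_pmE u U F G : #|U| = (k * u)%N ->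
  (forall M, is_pm U M -> F M = G M) -> pmE u U F = pmE u U G.
Proof.
by move=> hU h; apply/eqP; rewrite eq_le !pmE_mono // => M /h ->.
Qed.

Lemma pmE_eq0 u U F : #|U| = (k * u)%N ->
  (forall M, is_pm U M -> F M = 0) -> pmE u U F = 0.
Proof.
by move=> hU h; rewrite (eq_pmE (G := fun=> 0) hU h) pmE_cst.
Qed.

(* The probability that the random matching contains [a] given disjoint edges. *)
Definition pmpi u a : R := \prod_(j < a) ((u - j)%:R / 'C(k * (u - j), k)%:R).

Lemma pmpi_ge0 u a : 0 <= pmpi u a.
Proof. by apply: prodr_ge0 => i _; rewrite divr_ge0. Qed.

Lemma pmpiS u a : pmpi u.+1 a.+1 = u.+1%:R / 'C(k * u.+1, k)%:R * pmpi u a.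
Proof. by rewrite /pmpi big_ord_recl /= subn0. Qed.

(** Conditioning on the first removed edge: either it is one of the [a + 1] edges of [A], leaving
    [a] to be hit, or it avoids [cover A], with ['C(k * (u - a), k)] choices. The recursion closes
    since [(a + 1) + (u - a) = u + 1]. *)
Lemma pmE_subset u U A : #|U| = (k * u)%N ->
  pmE u U (fun M => (A \subset M)%:R) <= pmpi u #|A|.
Proof.
elim: u U A => [|u IH] U A hU /=.
  rewrite subset0 -cards_eq0; case: posnP => [->|_]; last exact: pmpi_ge0.
  by rewrite /pmpi big_ord0.
have hC : 'C(k * u.+1, k)%:R != 0 :> R.
  by rewrite pnatr_eq0 -lt0n -hU -card_edges_in (card_edges_in_gt0 hU).
have [A0|A0] := posnP #|A|.
  rewrite A0 /pmpi big_ord0 -[leRHS](pmE_cst 1 hU).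
  rewrite -[leLHS]/(pmE u.+1 U (fun M => (A \subset M)%:R)).
  by apply: pmE_mono => // M _; case: (A \subset M).
(* If [A] is not a matching in [U], no perfect matching of [U] contains it. *)
have [/andP[tA AU]|hn] := boolP (trivIset A && (A \subset edges_in U)); last first.
  rewrite -[leLHS]/(pmE u.+1 U (fun M => (A \subset M)%:R)) (pmE_eq0 hU) ?pmpi_ge0 //.
  move=> M /and3P[hM tM _]; case: (boolP (A \subset M)) => // AM.
  by rewrite (trivIsetS AM tM) (subset_trans AM hM) in hn.
have cA : #|cover A| = (k * #|A|)%N.
  move/eqP: tA => <-; rewrite mulnC -sum_nat_const; apply: eq_bigr => e /(subsetP AU).
  by rewrite inE => /andP[_ /eqP].
have cAU : cover A \subset U.
  by apply/bigcupsP => e /(subsetP AU); rewrite inE => /andP[].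
have aU : (#|A| <= u.+1)%N.
  by rewrite -(leq_pmul2l k0) -cA -hU subset_leq_card.
move: A0 aU cA; case ea : #|A| => [//|a] _ aU cA.
have step : \sum_(e in edges_in U) pmE u (U :\: e) (fun M => (A \subset e |: M)%:R) <=
   \sum_(e in edges_in U) ((e \in A)%:R * pmpi u a +
       (e \subset U :\: cover A)%:R * pmpi u a.+1).
  apply: ler_sum => e he.
  have hUe := card_diff_edge hU he.
  have [eA|eA] := boolP (e \in A).
    apply: ler_wpDr; first by rewrite mulr_ge0 ?pmpi_ge0.
    rewrite mul1r; have := IH _ (A :\ e) hUe.
    rewrite (_ : #|A :\ e| = a); last by move: ea; rewrite (cardsD1 e) eA => -[].
    by apply: le_trans; apply: pmE_mono => // M _; rewrite subDset.
  rewrite mul0r add0r.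
  have [eU|eU] := boolP (e \subset _).
    rewrite mul1r -ea; apply: le_trans (IH _ A hUe); apply: pmE_mono => // M _.
    by rewrite -subDset (setDidPl _) // disjoint_sym disjoints1.
  rewrite mul0r (pmE_eq0 hUe) // => M /and3P[hM _ _].
  case: (boolP (A \subset _)) => // AM; case/negP: eU.
  have AM' : A \subset M.
    by move: AM; rewrite -subDset (setDidPl _) // disjoint_sym disjoints1.
  rewrite subsetD; move: he; rewrite inE => /andP[-> _] /=.
  rewrite disjoint_sym disjoints_subset; apply/bigcupsP => f fA.
  have := subsetP hM _ (subsetP AM' _ fA); rewrite inE subsetD => /andP[/andP[_ h] _].
  by rewrite -disjoints_subset.
have c1 : \sum_(e in edges_in U) (e \in A)%:R = a.+1%:R :> R.
  rewrite -ea -sum1_card natr_sum [RHS]big_mkcond [LHS]big_mkcond /=; apply: eq_bigr => e _.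
  by case: (boolP (e \in A)) => [/(subsetP AU) ->|_] //; case: ifP.
have c2 : \sum_(e in edges_in U) (e \subset U :\: cover A)%:R = 'C(k * (u - a), k)%:R :> R.
  rewrite (_ : 'C(k * (u - a), k) = #|edges_in (U :\: cover A)|); last first.
    by rewrite card_edges_in cardsD (setIidPr cAU) hU cA -mulnBr subSS.
  rewrite -sum1_card natr_sum [RHS]big_mkcond [LHS]big_mkcond /=; apply: eq_bigr => e _.
  rewrite !inE; case: (boolP (e \subset _ :\: _)) => [h|_]; last by case: ifP.
  by rewrite (subset_trans h (subsetDl _ _)).
rewrite big_split -!mulr_suml c1 c2 in step.
rewrite ler_pdivrMr ?ltr0n ?(card_edges_in_gt0 hU) //; apply: (le_trans step).
rewrite card_edges_in hU pmpiS mulrAC divfK //.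
have -> : pmpi u a.+1 = pmpi u a * ((u - a)%:R / 'C(k * (u - a), k)%:R).
  by rewrite /pmpi big_ord_recr.
rewrite mulrCA [_ * (_ / _)]mulrC.
have -> : (u - a)%:R / 'C(k * (u - a), k)%:R * 'C(k * (u - a), k)%:R = (u - a)%:R :> R.
  have [->|ua] := posnP (u - a)%N; first by rewrite mul0r mul0r.
  by rewrite divfK // pnatr_eq0 -lt0n bin_gt0 leq_pmulr.
by rewrite /= [_ * (u - a)%:R]mulrC -mulrDl -natrD addSn subnKC.
Qed.

(** By [leq_exp_bin] the factor of index [j] is at most the inverse of [(w - j) ^+ k.-1], and
    [leq_exp_ffact] handles the product of these. Thus random perfect matchings are spread with
    [kappa = (w / 4) ^+ k.-1]. *)
Lemma pmpi_bound w a : (a <= w)%N -> pmpi w a <= ((4 / w%:R) ^+ k.-1) ^+ a.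
Proof.
move=> aw.
apply: (@le_trans _ _ (\prod_(j < a) ((w - j)%:R ^+ k.-1)^-1)).
  apply: ler_prod => j _; rewrite divr_ge0 //=.
  have wj : (0 < w - j)%N by rewrite subn_gt0 (leq_trans (ltn_ord j)).
  rewrite ler_pdivrMr ?ltr0n ?bin_gt0 ?leq_pmulr // mulrC ler_pdivlMr ?exprn_gt0 ?ltr0n //.
  by rewrite -exprS prednK // -natrX ler_nat leq_exp_bin.
rewrite prodfV prodrXl -natr_prod -ffact_prod -exprVn -exprM mulnC exprM.
rewrite lerXn2r ?nnegrE ?invr_ge0 ?exprn_ge0 ?divr_ge0 //.
have fp : (0 < w ^_ a)%N by rewrite ffact_gt0.
have [w0|w0] := posnP w.
  by move: aw; rewrite w0 leqn0 => /eqP ->; rewrite ffactn0 expr0 invr1.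
rewrite expr_div_n -[leLHS]mul1r ler_pdivrMr ?ltr0n // mulrAC ler_pdivlMr ?exprn_gt0 ?ltr0n //.
by rewrite mul1r -!natrX -natrM ler_nat leq_exp_ffact.
Qed.

(** The spread lemma applied to the law of the random perfect matching; a matching has [w < 2 ^ j]
    edges, so [j] halvings suffice. *)
Lemma has_pm_prob w U (j : nat) (q : R) :
  #|U| = (k * w)%N -> (0 < w < 2 ^ j)%N -> 0 < q -> j%:R * q <= 1 ->
  4 * 4 ^+ k.-1 <= q * w%:R ^+ k.-1 ->
  1 - j%:R * (4 * 4 ^+ k.-1 / (q * w%:R ^+ k.-1)) <=
  Ex (cst_on (edges_in U) (j%:R * q)) (fun B => (has_pm U B)%:R).
Proof.
move=> hU /andP[w0 wj] q0 jq hL.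
have j0 : (0 < j)%N by case: j wj {jq} => //; rewrite ltnS leqNgt w0.
have q1 : 0 < q <= 1.
  rewrite q0 /=; apply: le_trans jq; rewrite -{1}[q]mul1r ler_pM2r //.
  by rewrite ler1n.
have wk0 : 0 < w%:R ^+ k.-1 :> R by rewrite exprn_gt0 ?ltr0n.
have f0 : 0 < 4 ^+ k.-1 :> R by rewrite exprn_gt0.
pose kappa : R := ((4 / w%:R) ^+ k.-1)^-1.
have kE : q * kappa = q * w%:R ^+ k.-1 / 4 ^+ k.-1.
  by rewrite /kappa expr_div_n invf_div mulrA.
have kappa0 : 0 < kappa by rewrite invr_gt0 exprn_gt0 // divr_gt0 // ltr0n.
pose wgt M := pmE w U (fun M' => (M' == M)%:R).
have wgtP M : wgt M != 0 -> is_pm U M.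
  apply: contraR => hM; apply/eqP/(pmE_eq0 hU) => M' hM'.
  by rewrite (_ : M' == M = false) //; apply/negbTE; apply: contraNneq hM => <-.
have pm_card M : is_pm U M -> #|M| = w.
  move=> /and3P[hM tM /eqP cM]; apply/eqP; rewrite -(eqn_pmul2r k0); apply/eqP.
  rewrite [RHS]mulnC -hU -cM -(eqP tM) -sum_nat_const; apply: eq_bigr => e /(subsetP hM).
  by rewrite inE => /andP[_ /eqP].
have sumw (P : pred {set {set V}}) : \sum_(M | P M) wgt M = pmE w U (fun M => (P M)%:R).
  rewrite /wgt -pmE_sum; apply: eq_pmE => // M _; rewrite big_mkcond (bigD1 M) //= eqxx.
  rewrite big1 ?addr0 => [|M' /negbTE hM]; first by case: (P M).
  by rewrite eq_sym hM; case: ifP.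
have h := @spread_lemma R _ (edges_in U) q kappa q1 kappa0 j wgt.
have := h _ jq _ _ _.
have -> : \sum_M wgt M = 1 by rewrite sumw pmE_cst.
have -> : 4 / (q * kappa) = 4 * 4 ^+ k.-1 / (q * w%:R ^+ k.-1).
  by rewrite kE invf_div mulrA.
move=> h'; apply: le_trans (h' _ _ _ _) _.
- by rewrite kE ler_pdivlMr.
- by move=> M; rewrite /wgt -(pmE_cst 0 hU); apply: pmE_mono.
- move=> A; rewrite sumw; apply: le_trans (pmE_subset _ hU) _.
  have [aw|aw] := leqP #|A| w; first by rewrite /kappa invrK; apply: pmpi_bound.
  (* More than [w] edges: the factor of index [w] vanishes. *)
  rewrite /pmpi (bigD1 (Ordinal aw)) //= subnn mul0r mul0r.
  by rewrite exprn_ge0 // invr_ge0 ltW.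
- by move=> M /wgtP hM; rewrite (pm_card _ hM) wj andbT; case/and3P: hM.
apply: le_Ex => [|B].
  by apply: cst_on_unit_valued; rewrite jq mulr_ge0 // ltW.
case: existsP => // -[M /andP[/wgtP hM MB]].
by rewrite (_ : has_pm U B) //; apply/existsP; exists M; rewrite hM.
Qed.

End Matchings.

(** * Online sprinkling *)

Section Budget.
Variables (R : realFieldType) (T : finType).
Implicit Types (b r x : T -> R) (f : {set T} -> R).

(* The junk value 0 is a lower bound for the mean of a nonnegative function, so an
   overspent budget need not be treated separately. *)
Definition budgetEx b f : R := if [forall e, 0 <= b e] then Ex b f else 0.

Lemma eq_budgetEx b b' f g : b =1 b' -> f =1 g -> budgetEx b f = budgetEx b' g.
Proof.
move=> hb hf; rewrite /budgetEx (eq_Exp f hb) (eq_Ex b' hf).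
by rewrite (_ : [forall e, 0 <= b e] = [forall e, 0 <= b' e]) //; apply: eq_forallb => e; rewrite hb.
Qed.

Lemma budgetEx_ge0 b f : (forall e, b e <= 1) -> (forall A, 0 <= f A) -> 0 <= budgetEx b f.
Proof.
move=> hb hf; rewrite /budgetEx; case: forallP => // h; apply: Ex_ge0 => // e.
by rewrite h hb.
Qed.

Lemma budgetEx_sprinkle b r f : (forall e, b e <= 1) -> unit_valued r -> set_mono f ->
  (forall A, 0 <= f A) ->
  Ex r (fun B => budgetEx (fun e => b e - r e) (fun A => f (A :|: B))) <= budgetEx b f.
Proof.
move=> hb hr hf f0; rewrite /budgetEx.
have [/forallP h|h] := boolP [forall e, 0 <= b e - r e]; last first.
  by rewrite Ex_cst; apply: budgetEx_ge0.
have b0 e : 0 <= b e by have := h e; have /andP[r0 _] := hr e; lra.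
have -> : [forall e, 0 <= b e] by apply/forallP.
apply: Ex_sprinkle => // e.
- by rewrite b0 hb.
- by rewrite h /=; have := hb e; have /andP[r0 _] := hr e; lra.
- by rewrite subrK.
Qed.

End Budget.

(** * One round of the online process *)

Section Round.
Variables (R : realFieldType) (V : finType) (k w : nat) (s qf : R).
Hypotheses (k0 : (0 < k)%N) (w0 : (0 < w)%N) (hs : 0 < s <= 1 / 4) (hqf : 0 <= qf <= 1).
Implicit Types (U e : {set V}) (A B : {set {set V}}) (b x : {set V} -> R)
  (F G : {set {set V}} -> ({set V} -> R) -> R) (f : {set {set V}} -> R).
Local Notation E := (@edges_in V k).

(** Slightly above [s / #|E U|], so that a given edge is the only one to appear with probability at
    least [s / #|E U|]; [s <= 1 / 4] is enough for this. *)
Definition rate U : R := s / ((1 - 2 * s) * #|E U|%:R).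

(* One round: [round m U F] is the mean of [F A x], where [A] is the set of edges
   found and [x e] is the probability spent at the edge [e].  At most [m] attempts
   are made to find an edge; each spends [rate U] on every edge inside [U] and
   succeeds with probability [s].  When [k * w] vertices are left, [qf] is spent on
   all edges among them. *)
Fixpoint round m U F : R :=
  if m is m'.+1 then
    if (#|U| <= k * w)%N then Ex (cst_on (E U) qf) (fun B => F B (cst_on (E U) qf))
    else (1 - s) * round m' U (fun A x => F A (fun e => x e + cst_on (E U) (rate U) e))
       + s / #|E U|%:R * \sum_(e in E U) round m' (U :\: e)
           (fun A x => F (e |: A) (fun e' => x e' + cst_on (E U) (rate U) e'))
  else F set0 (fun=> 0).

(** Bounds the spending at an edge for every outcome of a round: attempts are made only while more
    than [k * w] vertices are left, which bounds [rate]. *)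
Definition max_spend m : R := m%:R * (s / ((1 - 2 * s) * 'C(k * w, k)%:R)) + qf.

Lemma one_minus_2s_gt0 : 0 < 1 - 2 * s. Proof. by case/andP: hs; lra. Qed.

Lemma card_E_gt0 u U : #|U| = (k * u)%N -> (w <= u)%N -> 0 < #|E U|%:R :> R.
Proof.
move=> hU wu; rewrite ltr0n card_edges_in bin_gt0 hU leq_pmulr //.
exact: leq_trans wu.
Qed.

Lemma rate_ge0 U : 0 <= rate U.
Proof.
by rewrite /rate divr_ge0 ?mulr_ge0 //; [case/andP: hs => /ltW|apply/ltW/one_minus_2s_gt0].
Qed.

Lemma rate_le U u : #|U| = (k * u)%N -> (w <= u)%N ->
  rate U <= s / ((1 - 2 * s) * 'C(k * w, k)%:R).
Proof.
move=> hU wu; rewrite /rate ler_pM2l; last by case/andP: hs.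
have c0 : 0 < 'C(k * w, k)%:R :> R by rewrite ltr0n bin_gt0 leq_pmulr.
rewrite lef_pV2 ?posrE ?mulr_gt0 ?one_minus_2s_gt0 ?(card_E_gt0 hU) // ler_pM2l ?one_minus_2s_gt0 //.
rewrite ler_nat card_edges_in hU; apply: leq_bin2l; by rewrite leq_mul2l wu orbT.
Qed.

Lemma rate_le1 U u : #|U| = (k * u)%N -> (w <= u)%N -> rate U <= 1.
Proof.
move=> hU wu; have h := card_E_gt0 hU wu.
have h1 : 1 <= #|E U|%:R :> R by move: h; rewrite ltr0n ler1n.
rewrite /rate ler_pdivrMr ?mulr_gt0 ?one_minus_2s_gt0 // mul1r.
apply: (@le_trans _ _ (1 - 2 * s)); first by case/andP: hs; lra.
by rewrite ler_peMr // ltW ?one_minus_2s_gt0.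
Qed.

Lemma max_spend0 m : 0 <= max_spend m.
Proof.
rewrite /max_spend addr_ge0 //; last by case/andP: hqf.
rewrite mulr_ge0 // divr_ge0 ?mulr_ge0 //; [by case/andP: hs => /ltW|exact/ltW/one_minus_2s_gt0].
Qed.

(** The comparison is required only for spendings that can occur; the bound by [max_spend] is what
    makes the Chernoff estimate applicable later. *)
Lemma round_le m u U F G : #|U| = (k * u)%N -> (w <= u)%N ->
  (forall A x, (forall e, 0 <= x e <= cst_on (E U) (max_spend m) e) -> F A x <= G A x) ->
  round m U F <= round m U G.
Proof.
elim: m u U F G => [|m IH] u U F G hU wu h /=.
  by apply: h => e; rewrite lexx /= /cst_on; case: ifP => // _; rewrite max_spend0.
have h0 : 0 <= s / ((1 - 2 * s) * 'C(k * w, k)%:R).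
  rewrite divr_ge0 ?mulr_ge0 //; [by case/andP: hs => /ltW|exact/ltW/one_minus_2s_gt0].
case: ifP => [_|/negbT]; last rewrite -ltnNge hU ltn_pmul2l // => wu'.
  apply: le_Ex => [|A]; first by apply: cst_on_unit_valued.
  apply: h => e; rewrite /cst_on; case: ifP => // _; last by rewrite !lexx.
  case/andP: hqf => -> _ /=; rewrite /max_spend lerDr mulr_ge0 //.
have lub := rate_le hU wu.
have hx x (U' : {set V}) : U' \subset U -> (forall e, 0 <= x e <= cst_on (E U') (max_spend m) e) ->
    forall e, 0 <= x e + cst_on (E U) (rate U) e <= cst_on (E U) (max_spend m.+1) e.
  move=> UU hx e; have /andP[x0 x1] := hx e; move: x1; rewrite /cst_on.
  case: ifP => [/(subsetP (edges_inS k UU)) ->|_] x1.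
    rewrite addr_ge0 ?rate_ge0 //= /max_spend -natr1 mulrDl mul1r addrAC.
    exact: lerD.
  have -> : x e = 0 by apply/eqP; rewrite eq_le x1.
  rewrite !add0r; case: ifP => _; last by rewrite lexx.
  rewrite rate_ge0 /= /max_spend -natr1 mulrDl mul1r; apply: le_trans lub _.
  rewrite addrAC; case/andP: hqf => q0 _; have := mulr_ge0 (ler0n R m) h0; lra.
apply: lerD.
  rewrite ler_wpM2l //; first by case/andP: hs; lra.
  by apply: IH hU wu _ => A x h1; apply: h; apply: hx h1.
rewrite ler_wpM2l ?divr_ge0 //; first by case/andP: hs => /ltW.
apply: ler_sum => e he; case: u hU wu wu' => // u hU _ wu'.
apply: IH (card_diff_edge hU he) wu' _ => A x h1; apply: h; apply: hx h1; exact: subsetDl.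
Qed.

Lemma round_sum m U (I : Type) (l : seq I) (P : pred I) (F : I -> {set {set V}} -> ({set V} -> R) -> R) :
  round m U (fun A x => \sum_(i <- l | P i) F i A x) = \sum_(i <- l | P i) round m U (F i).
Proof.
elim: m U F => [|m IH] U F //=; case: ifP => _; first by rewrite Ex_sum.
rewrite IH big_split /= mulr_sumr; congr (_ + _).
rewrite -mulr_sumr exchange_big /=; congr (_ * _).
by apply: eq_bigr => e _; rewrite IH.
Qed.

Lemma round_add m U F G :
  round m U (fun A x => F A x + G A x) = round m U F + round m U G.
Proof.
elim: m U F G => [|m IH] U F G //=; case: ifP => _; first by rewrite Ex_add.
rewrite IH; under eq_bigr => e _ do rewrite IH.
by rewrite big_split /= !mulrDr addrACA.
Qed.

Lemma round_scale m U c F : round m U (fun A x => c * F A x) = c * round m U F.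
Proof.
elim: m U F => [|m IH] U F //=; case: ifP => _; first by rewrite Ex_scale.
rewrite IH; under eq_bigr => e _ do rewrite IH.
by rewrite -mulr_sumr mulrDr mulrCA; congr (_ + _); rewrite mulrCA.
Qed.

Lemma round_cst m u U c : #|U| = (k * u)%N -> (w <= u)%N -> round m U (fun _ _ => c) = c.
Proof.
elim: m u U => [|m IH] u U hU wu //=; case: ifP => [_|/negbT].
  by rewrite Ex_cst.
rewrite -ltnNge hU ltn_pmul2l // => wu'.
have E0 := lt0r_neq0 (card_E_gt0 hU wu).
rewrite (IH _ _ hU wu) (eq_bigr (fun=> c)) => [|e he]; last first.
  by case: u hU wu wu' => // u hU _ wu'; apply: IH (card_diff_edge hU he) wu'.
by rewrite sumr_const -[c *+ _]mulr_natr; field.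
Qed.

(** The idealised round is realised inside a true random set of density [b]. Each attempt becomes a
    random set of density [rate U], paid for by [budgetEx_sprinkle]; by [one_step] and monotonicity
    it is at least as good as one uniform edge found with probability [s]. *)
Lemma round_budget m u U b f F : #|U| = (k * u)%N -> (w <= u)%N ->
  (forall e, b e <= 1) -> set_mono f -> (forall A, 0 <= f A) ->
  (forall A x, (forall e, 0 <= x e) ->
      F A x <= budgetEx (fun e => b e - x e) (fun B => f (A :|: B))) ->
  round m U F <= budgetEx b f.
Proof.
elim: m u U b f F => [|m IH] u U b f F hU wu hb hf f0 hF /=.
  apply: (le_trans (hF _ _ (fun=> lexx 0))).
  rewrite le_eqVlt; apply/orP; left; apply/eqP; apply: eq_budgetEx => [e|B].
    by rewrite subr0.
  by rewrite set0U.
case: ifP => [_|/negbT].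
  have hp : unit_valued (cst_on (E U) qf) by apply: cst_on_unit_valued.
  apply: le_trans (budgetEx_sprinkle hb hp hf f0); apply: le_Ex => // B.
  apply: le_trans (hF _ _ _) _ => [e|]; first by case/andP: (hp e).
  rewrite le_eqVlt; apply/orP; left; apply/eqP; apply: eq_budgetEx => // A.
  by rewrite setUC.
rewrite -ltnNge hU ltn_pmul2l // => wu'.
set Q := E U; set c := rate U.
have hc : 0 <= c <= 1 by rewrite rate_ge0 (rate_le1 hU).
have hp : unit_valued (cst_on Q c) by apply: cst_on_unit_valued.
have hb' e : b e - cst_on Q c e <= 1 by have := hb e; have /andP[] := hp e; lra.
pose b' e := b e - cst_on Q c e.
have E0 : (0 < #|Q|)%N by rewrite -(ltr0n R); apply: card_E_gt0 hU wu.
have E0' : 0 < #|Q|%:R :> R by rewrite ltr0n.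
have E0n := lt0r_neq0 E0'; have nz2s := lt0r_neq0 one_minus_2s_gt0.
pose g B := budgetEx b' (fun A => f (A :|: B)).
have mono_fU B : set_mono (fun A => f (A :|: B)) by move=> A A' h; apply/hf/setSU.
have gmono : set_mono g.
  move=> B C BC; rewrite /g /budgetEx; case: forallP => // hb0; apply: le_Ex => [e|A].
    by rewrite hb0 hb'.
  by apply/hf/setUS.
apply: le_trans (budgetEx_sprinkle hb hp hf f0); rewrite -/b' -/g.
have hcc : s / #|Q|%:R <= c * (1 - #|Q|%:R * c).
  rewrite /c /rate -/Q.
  have -> : #|Q|%:R * (s / ((1 - 2 * s) * #|Q|%:R)) = s / (1 - 2 * s).
    by field; rewrite ?nz2s ?E0n.
  have -> : s / ((1 - 2 * s) * #|Q|%:R) = (s / #|Q|%:R) / (1 - 2 * s).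
    by field; rewrite ?nz2s ?E0n.
  rewrite -mulrA ler_peMr ?divr_ge0 //; first by case/andP: hs => /ltW.
  rewrite mulrC ler_pdivlMr ?one_minus_2s_gt0 // mul1r lerD2l lerN2 ler_pdivrMr ?one_minus_2s_gt0 //.
  by case/andP: hs; nra.
apply: le_trans (one_step hc E0 hcc gmono).
apply: lerD.
  rewrite ler_wpM2l //; first by case/andP: hs; lra.
  apply: (IH u) => // A x hx.
  apply: le_trans (hF _ _ _) _ => [e|].
    by rewrite addr_ge0 //; case/andP: (hp e).
  rewrite le_eqVlt; apply/orP; left; apply/eqP; apply: eq_budgetEx => [e|B].
    by rewrite /b' opprD addrA addrAC.
  by rewrite setU0.
rewrite ler_wpM2l ?divr_ge0 //; first by case/andP: hs => /ltW.
apply: ler_sum => e he; case: u hU wu wu' => // u hU _ wu'.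
apply: (IH u) => // [|A x hx]; first exact: card_diff_edge hU he.
apply: le_trans (hF _ _ _) _ => [e'|].
  by rewrite addr_ge0 //; case/andP: (hp e').
rewrite le_eqVlt; apply/orP; left; apply/eqP; apply: eq_budgetEx => [e'|B].
  by rewrite /b' opprD addrA addrAC.
by rewrite -setUA setUC.
Qed.

Lemma round_spendS m u U e : #|U| = (k * u)%N -> (w < u)%N ->
  round m.+1 U (fun _ x => x e) = (1 - s) * round m U (fun _ x => x e) +
    s / #|E U|%:R * (\sum_(e' in E U) round m (U :\: e') (fun _ x => x e)) +
    cst_on (E U) (rate U) e.
Proof.
move=> hU wu /=; rewrite leqNgt hU ltn_pmul2l // wu /=.
have E0' := lt0r_neq0 (card_E_gt0 hU (ltnW wu)).
rewrite round_add (round_cst _ _ hU (ltnW wu)).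
rewrite (eq_bigr (fun e' => round m (U :\: e') (fun _ x => x e) + cst_on (E U) (rate U) e)); last first.
  move=> e' he'; rewrite round_add; congr (_ + _).
  by case: u hU wu => // u hU wu; apply: round_cst (card_diff_edge hU he') wu.
rewrite big_split /= sumr_const -[cst_on _ _ _ *+ _]mulr_natr.
by field.
Qed.

(** An attempt finds a given edge of [E U] with probability [s / #|E U|], no more than the [rate U]
    spent there; in the final stage the two means agree. *)
Lemma round_hit m u U e : #|U| = (k * u)%N -> (w <= u)%N ->
  round m U (fun A _ => (e \in A)%:R) <= round m U (fun _ x => x e).
Proof.
elim: m u U => [|m IH] u U hU wu; first by rewrite /= inE.
have [uw|wu'] := leqP u w.
  by rewrite /= hU leq_mul2l uw orbT Ex_in Ex_cst.
rewrite (round_spendS _ _ hU) //= leqNgt hU ltn_pmul2l // wu' /=.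
set Q := E U; set c := rate U.
have E0' : 0 < #|Q|%:R :> R by apply: card_E_gt0 hU wu.
have s0 : 0 < s by case/andP: hs.
have hcc : s / #|Q|%:R <= c.
  rewrite /c /rate ler_pM2l // lef_pV2 ?posrE ?mulr_gt0 ?one_minus_2s_gt0 //.
  by rewrite ler_piMl ?(ltW E0') //; lra.
have hstep e' : e' \in Q -> round m (U :\: e') (fun A _ => (e \in e' |: A)%:R) <=
   (e == e')%:R + round m (U :\: e') (fun _ x => x e).
  move=> he'; case: u hU wu wu' => // u hU _ wu'.
  have hUe := card_diff_edge hU he'.
  apply: (@le_trans _ _ ((e == e')%:R + round m (U :\: e') (fun A _ => (e \in A)%:R))); last first.
    by rewrite lerD2l; apply: IH hUe wu'.
  rewrite -(round_cst m (e == e')%:R hUe wu') -round_add.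
  apply: (round_le hUe wu') => A x _.
  by rewrite !inE; case: (e == e'); case: (e \in A); rewrite /= ?addr0 ?add0r // lerDl ler01.
rewrite -addrA; apply: lerD.
  by rewrite ler_wpM2l //; [case/andP: hs; lra | apply: IH hU wu].
apply: (@le_trans _ _ (s / #|Q|%:R * \sum_(e' in Q) ((e == e')%:R + round m (U :\: e') (fun _ x => x e)))).
  by apply: ler_wpM2l; [rewrite divr_ge0 // ltW|apply: ler_sum].
rewrite big_split /= mulrDr [leLHS]addrC lerD2l /cst_on.
case: (boolP (e \in Q)) => [eQ|eQ].
  rewrite (bigD1 e) //= eqxx big1 ?addr0 ?mulr1 // => e' /andP[_]; rewrite eq_sym.
  by move/negbTE->.
rewrite big1 ?mulr0 // => e' he'; case: eqVneq => // ee.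
by rewrite ee he' in eQ.
Qed.

(* With [a = 1 / (1 - 2 s)] and [b = 'C(k w, k) qf], the bound [(a u + b) / 'C(k u, k)]
   is reproduced exactly by one attempt, because a given edge survives a uniform
   removal with probability ['C(k (u - 1), k) / 'C(k u, k)]. *)
Lemma round_spend m u U e : #|U| = (k * u)%N -> (w <= u)%N ->
  round m U (fun _ x => x e) <=
  cst_on (E U) ((u%:R / (1 - 2 * s) + 'C(k * w, k)%:R * qf) / 'C(k * u, k)%:R) e.
Proof.
have s0 : 0 < s by case/andP: hs.
have q0 : 0 <= qf by case/andP: hqf.
have a0 : 0 < (1 - 2 * s)^-1 by rewrite invr_gt0 one_minus_2s_gt0.
have rhs0 v : 0 <= (v%:R / (1 - 2 * s) + 'C(k * w, k)%:R * qf) / 'C(k * v, k)%:R.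
  by rewrite divr_ge0 // addr_ge0 ?mulr_ge0 // ltW.
elim: m u U => [|m IH] u U hU wu.
  by rewrite /= /cst_on; case: ifP.
have [uw|wu'] := leqP u w.
  rewrite /= hU leq_mul2l uw orbT Ex_cst /cst_on; case: ifP => // _.
  have -> : u = w by apply/eqP; rewrite eqn_leq uw.
  have C0 : 0 < 'C(k * w, k)%:R :> R by rewrite ltr0n bin_gt0 leq_pmulr.
  by rewrite ler_pdivlMr // mulrC lerDr mulr_ge0 // ltW.
rewrite (round_spendS _ _ hU) //.
case: u hU wu wu' => // u hU wu wu'.
have E0' : 0 < #|E U|%:R :> R by apply: card_E_gt0 hU wu.
have [eU|eU] := boolP (e \in E U); last first.
  rewrite /cst_on (negbTE eU) addr0.
  have z1 : round m U (fun _ x => x e) <= 0.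
    by apply: le_trans (IH _ _ hU wu) _; rewrite /cst_on (negbTE eU).
  have z2 : \sum_(e' in E U) round m (U :\: e') (fun _ x => x e) <= 0.
    apply: sumr_le0 => e' he'; apply: le_trans (IH _ _ (card_diff_edge hU he') wu') _.
    rewrite /cst_on; case: ifP => // /(subsetP (edges_inS k (subsetDl _ _))).
    by rewrite (negbTE eU).
  have h1 : (1 - s) * round m U (fun _ x => x e) <= 0.
    by rewrite pmulr_rle0 //; case/andP: hs; lra.
  have h2 : s / #|E U|%:R * (\sum_(e' in E U) round m (U :\: e') (fun _ x => x e)) <= 0.
    by rewrite pmulr_rle0 // divr_gt0.
  lra.
rewrite /cst_on eU.
have cU : #|E U| = 'C(k * u.+1, k) by rewrite card_edges_in hU.
set b := 'C(k * w, k)%:R * qf.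
pose v := (u%:R / (1 - 2 * s) + b) / 'C(k * u, k)%:R.
have Cu0 : 0 < 'C(k * u, k)%:R :> R.
  by rewrite ltr0n bin_gt0 leq_pmulr // (leq_trans w0).
have z2 : \sum_(e' in E U) round m (U :\: e') (fun _ x => x e) <= u%:R / (1 - 2 * s) + b.
  apply: (@le_trans _ _ (\sum_(e' in E U) (if e' \in E (U :\: e) then v else 0))).
    apply: ler_sum => e' he'; apply: le_trans (IH _ _ (card_diff_edge hU he') wu') _.
    move: eU he'; rewrite /cst_on !inE !subsetD => /andP[-> ->] /andP[-> ->].
    by rewrite !andbT disjoint_sym.
  rewrite -big_mkcondr /= sumr_const.
  rewrite (_ : #|_| = 'C(k * u, k)); last first.
    rewrite -(card_diff_edge hU eU) -card_edges_in; apply: eq_card => e'.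
    rewrite -[in LHS]topredE /= andb_idl //; exact/subsetP/edges_inS/subsetDl.
  by rewrite -[v *+ _]mulr_natr /v divfK // lt0r_neq0.
have z1 := IH _ _ hU wu; rewrite /cst_on eU -/b -cU in z1.
rewrite -cU /rate.
have h1 : (1 - s) * round m U (fun _ x => x e) <= (1 - s) * ((u.+1%:R / (1 - 2 * s) + b) / #|E U|%:R).
  by rewrite ler_wpM2l //; case/andP: hs; lra.
have h2 : s / #|E U|%:R * (\sum_(e' in E U) round m (U :\: e') (fun _ x => x e)) <=
   s / #|E U|%:R * (u%:R / (1 - 2 * s) + b).
  by rewrite ler_wpM2l // divr_ge0 // ltW.
apply: le_trans (lerD (lerD h1 h2) (lexx _)) _.
rewrite le_eqVlt; apply/orP; left; apply/eqP.
rewrite -natr1; field.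
by rewrite (lt0r_neq0 E0') (lt0r_neq0 one_minus_2s_gt0).
Qed.

(** The term [2 ^+ u * (1 - s / 2) ^+ m] is a potential: an attempt halves [2 ^+ u] with probability
    [s], and [(1 - s) + s / 2 = 1 - s / 2]. At [m = 0] the bound is not positive. *)
Lemma round_has_pm m u U (z : R) : #|U| = (k * u)%N -> (w <= u)%N -> 0 <= z ->
  (forall U', #|U'| = (k * w)%N -> 1 - z <= Ex (cst_on (E U') qf) (fun B => (has_pm k U' B)%:R)) ->
  1 - z - 2 ^+ u * (1 - s / 2) ^+ m <= round m U (fun A _ => (has_pm k U A)%:R).
Proof.
move=> hU wu z0 hz; elim: m u U hU wu => [|m IH] u U hU wu.
  apply: (@le_trans _ _ 0) => //.
  rewrite expr0 mulr1; have : 1 <= 2 ^+ u :> R by rewrite exprn_ege1 // ler1n.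
  lra.
have t0 : 0 <= 1 - s / 2 by case/andP: hs; lra.
have [uw|wu'] := leqP u w.
  rewrite /= hU leq_mul2l uw orbT.
  have {}uw : u = w by apply/eqP; rewrite eqn_leq uw.
  apply: le_trans (hz U _); last by rewrite hU uw.
  by rewrite lerBlDr lerDl mulr_ge0 // exprn_ge0.
rewrite /= leqNgt hU ltn_pmul2l // wu' /=.
case: u hU wu wu' => // u hU wu wu'.
have E0' : 0 < #|E U|%:R :> R by apply: card_E_gt0 hU wu.
pose X : R := 1 - z - 2 ^+ u * (1 - s / 2) ^+ m.
have h2 : #|E U|%:R * X <= \sum_(e in E U) round m (U :\: e) (fun A _ => (has_pm k U (e |: A))%:R).
  rewrite mulr_natl -sumr_const; apply: ler_sum => e he.
  have hUe := card_diff_edge hU he.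
  apply: le_trans (IH _ _ hUe wu') _; apply: (round_le hUe wu') => A x _.
  have [/existsP[M /andP[hM MA]]|_] := boolP (has_pm k (U :\: e) A); last by rewrite ler0n.
  rewrite (_ : has_pm k U _) //; apply/existsP; exists (e |: M).
  by rewrite (is_pmU1 k0 he hM) setUS.
have h1 := IH _ _ hU wu.
have s0 : 0 < s by case/andP: hs.
apply: le_trans (lerD (ler_wpM2l _ h1) (ler_wpM2l _ h2)); last first.
- by rewrite divr_ge0 // ltW.
- by case/andP: hs; lra.
rewrite mulrA divfK ?lt0r_neq0 // /X !exprS.
rewrite le_eqVlt; apply/orP; left; apply/eqP.
by field.
Qed.

End Round.

(** * Packings of edge-disjoint perfect matchings *)

Section Packing.
Variables (V : finType).
Implicit Types (A B H M : {set {set V}}) (F : {set {set {set V}}}).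

Definition packing H F :=
  [forall M in F, perfect_matching H M] &&
  [forall M1 in F, forall M2 in F, (M1 != M2) ==> [disjoint M1 & M2]].

Definition packing_number H : nat := (\max_(F | packing H F) #|F|)%N.
Local Notation nu := packing_number.

Lemma packingP H F : reflect
  ((forall M, M \in F -> perfect_matching H M) /\
   (forall M1 M2, M1 \in F -> M2 \in F -> M1 != M2 -> [disjoint M1 & M2])) (packing H F).
Proof.
apply: (iffP andP) => [[/forall_inP h1 /forall_inP h2]|[h1 h2]]; split=> //.
- by move=> M1 M2 hM1 hM2 hM; have /forall_inP/(_ _ hM2)/implyP := h2 _ hM1; apply.
- exact/forall_inP.
- by apply/forall_inP => M1 hM1; apply/forall_inP => M2 hM2; apply/implyP; apply: h2.
Qed.

Lemma packing_number_witness H : exists2 F, packing H F & #|F| = nu H.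
Proof.
have h0 : packing H set0 by apply/packingP; split=> [M|M1 M2]; rewrite inE.
have [|F hF hE] := @eq_bigmax_cond _ (packing H) (fun F => #|F|); last first.
  by exists F => //; rewrite -hE.
by apply/card_gt0P; exists set0.
Qed.

Lemma leq_packing_number H F : packing H F -> (#|F| <= nu H)%N.
Proof. by move=> hF; apply: (@leq_bigmax_cond _ (packing H) (fun F => #|F|)). Qed.

Lemma packing_number_mono A B : A \subset B -> (nu A <= nu B)%N.
Proof.
move=> AB; have [F /packingP[h1 h2] <-] := packing_number_witness A.
apply/leq_packing_number/packingP; split=> // M /h1/and3P[h3 h4 h5].
by rewrite /perfect_matching (subset_trans h3 AB) h4.
Qed.

Lemma packing_numberU A B : (0 < #|V|)%N -> [disjoint A & B] ->
  (nu A + nu B <= nu (A :|: B))%N.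
Proof.
move=> V0 AB.
have [F /packingP[hF1 hF2] <-] := packing_number_witness A.
have [G /packingP[hG1 hG2] <-] := packing_number_witness B.
have FG M M' : M \in F -> M' \in G -> [disjoint M & M'].
  move=> /hF1/and3P[h1 _ _] /hG1/and3P[h2 _ _].
  by apply: disjointWl h1 _; apply: disjointWr h2 _.
(* A common member would be disjoint from itself, hence empty, and could not cover a nonempty vertex
   set. *)
have dFG : [disjoint F & G].
  rewrite -setI_eq0; apply/eqP/setP => M; rewrite !inE; apply/negP => /andP[hF hG].
  have := FG _ _ hF hG; rewrite -setI_eq0 setIid => /eqP M0.
  move: (hF1 _ hF); rewrite M0 => /and3P[_ _ /eqP]; rewrite /cover big_set0 => h.
  by move: V0; rewrite -cardsT -h cards0.
have -> : (#|F| + #|G| = #|F :|: G|)%N.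
  by rewrite cardsU (disjoint_setI0 dFG) cards0 subn0.
apply/leq_packing_number/packingP; split.
  move=> M; rewrite inE => /orP[/hF1|/hG1] /and3P[h1 h2 h3].
    by rewrite /perfect_matching h2 h3 (subset_trans h1) ?subsetUl.
  by rewrite /perfect_matching h2 h3 (subset_trans h1) ?subsetUr.
move=> M1 M2; rewrite !inE => /orP[h1|h1] /orP[h2|h2].
- exact: hF2.
- by move=> _; apply: FG.
- by move=> _; rewrite disjoint_sym; apply: FG.
- exact: hG2.
Qed.

Lemma has_pm_packing_number k A : has_pm k [set: V] A -> (0 < nu A)%N.
Proof.
case/existsP => M /andP[/and3P[_ tM cM] MA].
rewrite -(cards1 M); apply/leq_packing_number/packingP; split.
  by move=> M'; rewrite inE => /eqP ->; rewrite /perfect_matching MA tM.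
by move=> M1 M2; rewrite !inE => /eqP -> /eqP ->; rewrite eqxx.
Qed.

Lemma packing_number_card k n H : (0 < k)%N -> #|V| = (k * n)%N ->
  H \subset edges_in k [set: V] -> (n * nu H <= #|H|)%N.
Proof.
move=> k0 hV hH; have [F /packingP[h1 h2] <-] := packing_number_witness H.
have tF : trivIset F.
  by apply/trivIsetP => M1 M2; apply: h2.
have cF : cover F \subset H by apply/bigcupsP => M /h1/and3P[].
apply: leq_trans (subset_leq_card cF); rewrite -(eqP tF) mulnC -sum_nat_const.
apply: leq_sum => M /h1/and3P[MH tM /eqP cM].
rewrite -(leq_pmul2l k0) -hV -cardsT -cM -(eqP tM) mulnC -sum_nat_const.
apply: leq_sum => e eM.
by have := subsetP hH _ (subsetP MH _ eM); rewrite inE => /andP[_ /eqP ->].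
Qed.

End Packing.

(** * Repeated rounds under one budget *)

Section Iterate.
Variables (R : realFieldType) (V : finType) (k w n m : nat) (s qf z : R).
Hypotheses (k0 : (0 < k)%N) (w0 : (0 < w)%N) (hs : 0 < s <= 1 / 4) (hqf : 0 <= qf <= 1).
Hypotheses (hV : #|V| = (k * n)%N) (wn : (w <= n)%N) (z0 : 0 <= z).
Hypothesis hz : forall U : {set V}, #|U| = (k * w)%N ->
  1 - z <= Ex (cst_on (edges_in k U) qf) (fun B => (has_pm k U B)%:R).
Implicit Types (e : {set V}) (A B C : {set {set V}}) (b x : {set V} -> R).
Local Notation K := (edges_in k [set: V]).
Local Notation nu := (@packing_number V).
Local Notation round := (@round R V k w s qf m [set: V]).

(** The bounds of [round_spend] and [round_has_pm] for a round started at the full vertex set. *)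
Definition spend_mean : R := (n%:R / (1 - 2 * s) + 'C(k * w, k)%:R * qf) / 'C(k * n, k)%:R.
Definition round_success : R := 1 - z - 2 ^+ n * (1 - s / 2) ^+ m.
Local Notation mu := spend_mean.
Local Notation gam := round_success.

Let hT : #|[set: V]| = (k * n)%N. Proof. by rewrite cardsT. Qed.

Lemma spend_mean_ge0 : 0 <= mu.
Proof.
rewrite divr_ge0 // addr_ge0 ?mulr_ge0 // ?invr_ge0; last by case/andP: hqf.
exact/ltW/one_minus_2s_gt0.
Qed.

(** Linearity of [round]: [g] prices each edge found and [h] the budget spent at each edge. Both
    means are at most [mu] per edge, as [round_hit] bounds finding by spending. *)
Lemma round_lower a (g h : {set V} -> R) :
  (forall e, 0 <= g e) -> (forall e, 0 <= h e) ->
  a + gam - \sum_(e in K) g e * mu - \sum_(e in K) h e * mu <=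
  round (fun A x => a + (has_pm k [set: V] A)%:R - \sum_e g e * (e \in A)%:R - \sum_(e in K) h e * x e).
Proof.
move=> hg hh.
have -> : round (fun A x => a + (has_pm k [set: V] A)%:R - \sum_e g e * (e \in A)%:R - \sum_(e in K) h e * x e)
  = a + round (fun A _ => (has_pm k [set: V] A)%:R)
    - (\sum_e g e * round (fun A _ => (e \in A)%:R)) - \sum_(e in K) h e * round (fun _ x => x e).
  have E1 : \sum_e g e * round (fun A _ => (e \in A)%:R) =
     round (fun A _ => \sum_e g e * (e \in A)%:R).
    by rewrite round_sum; apply: eq_bigr => e _; rewrite round_scale.
  have E2 : \sum_(e in K) h e * round (fun _ x => x e) =
     round (fun _ x => \sum_(e in K) h e * x e).
    by rewrite round_sum; apply: eq_bigr => e _; rewrite round_scale.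
  have oppE F : - round F = round (fun A x => - F A x).
    rewrite -mulN1r -round_scale.
    by apply/eqP; rewrite eq_le; apply/andP; split;
      apply: (round_le k0 w0 hs hqf hT wn) => A x _; rewrite mulN1r.
  by rewrite E1 E2 !oppE -[X in X + _ + _ + _](round_cst s qf k0 w0 m a hT wn) -!round_add.
have sp e := round_spend k0 w0 hs hqf m e hT wn.
apply: lerB; first apply: lerB.
- by rewrite lerD2l; apply: (round_has_pm k0 w0 hs hqf m hT wn z0 hz).
- rewrite [leRHS]big_mkcond /=; apply: ler_sum => e _.
  have h1 := le_trans (round_hit k0 w0 hs hqf m e hT wn) (sp e).
  move: h1; rewrite /cst_on; case: ifP => _ h1; first by rewrite ler_wpM2l.
  by rewrite mulr_ge0_le0.
apply: ler_sum => e eK; rewrite ler_wpM2l //.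
by have := sp e; rewrite /cst_on eK.
Qed.

(** These properties of a decaying exponential carry the Chernoff argument over any real field;
    [expR] is substituted later. *)
Variables (phi : R -> R) (tau : R).
Hypotheses (tau0 : 0 <= tau) (phi0 : forall y, 0 <= phi y) (phi1 : forall y, y < 0 -> 1 <= phi y)
  (phiB : forall y x : R, 0 <= x <= max_spend k w s qf m -> phi (y - x) <= phi y * (1 + tau * x)).

(* Backward induction on the number [j] of rounds left; [C] is the set of edges
   found so far.  The terms in [mu] pay for edges found twice, and the last term,
   with [phi y] standing for [exp (- theta y)], is a Chernoff bound that outweighs
   everything else once some [b e] is negative. *)
Lemma iterate_rounds (Z j : nat) b C (c : nat) :
  (forall e, b e <= 1) -> (forall e, e \notin K -> b e = 0) ->
  (c <= nu C)%N -> (c + j <= Z)%N ->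
  c%:R + j%:R * gam - j%:R * mu * #|C|%:R - j%:R ^+ 2 * mu ^+ 2 * #|K|%:R
   - Z%:R * (1 + tau * mu) ^+ j * (\sum_(e in K) phi (b e)) <=
  budgetEx b (fun B => (nu (C :|: B))%:R).
Proof.
have mu0 := spend_mean_ge0.
elim: j b C c => [|j IH] b C c hb hbK hc hZ.
  rewrite !mul0r expr0 expr0n !mul0r !subr0 addr0 mulr1.
  rewrite /budgetEx; case: forallP => [hb0|].
    apply: (@le_trans _ _ (nu C)%:R).
      rewrite lerBlDr -[leLHS]addr0 lerD ?ler_nat // mulr_ge0 // sumr_ge0 //.
    rewrite -[leLHS](Ex_cst b); apply: le_Ex => [e|B]; first by rewrite hb0 hb.
    by rewrite ler_nat packing_number_mono // subsetUl.
  (* Overspent at [e]: the right side is 0, while [phi (b e) >= 1] makes the subtracted term at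
     least [Z >= c]. *)
  move/forallP/forallPn => [e]; rewrite -ltNge => be.
  have eK : e \in K by apply: contraLR be => /hbK ->; rewrite ltxx.
  rewrite subr_le0; apply: (@le_trans _ _ Z%:R).
    by rewrite ler_nat; move: hZ; rewrite addn0.
  rewrite ler_peMr // (bigD1 e) //= -[leLHS]addr0 lerD ?phi1 // sumr_ge0 //.
pose hp A : R := (has_pm k [set: V] A)%:R.
pose Y := Z%:R * (1 + tau * mu) ^+ j.
have Y0 : 0 <= Y by rewrite mulr_ge0 // exprn_ge0 // addr_ge0 // mulr_ge0.
(* An edge found now costs 1 if it is in [C], and [j * mu] for being hit again in later rounds; [h]
   is the first-order growth of the [phi] term. *)
pose g e : R := (e \in C)%:R + j%:R * mu.
pose h e : R := Y * (phi (b e) * tau).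
pose a : R := c%:R + j%:R * gam - j%:R * mu * #|C|%:R - j%:R ^+ 2 * mu ^+ 2 * #|K|%:R
   - Y * (\sum_(e in K) phi (b e)).
have g0 e : 0 <= g e by rewrite addr_ge0 // mulr_ge0.
have h0 e : 0 <= h e by rewrite /h; apply: mulr_ge0 => //; apply: mulr_ge0.
apply: (@le_trans _ _ (a + gam - \sum_(e in K) g e * mu - \sum_(e in K) h e * mu)).
  have sg : \sum_(e in K) g e * mu <= mu * #|C|%:R + j%:R * mu ^+ 2 * #|K|%:R.
    rewrite -mulr_suml big_split /= sumr_const -[_ * mu *+ _]mulr_natr mulrDl.
    have hCK : \sum_(e in K) (e \in C)%:R <= #|C|%:R :> R.
      rewrite -sum1_card natr_sum [leRHS]big_mkcond [leLHS]big_mkcond /=.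
      by apply: ler_sum => e _; case: (e \in C); case: ifP.
    apply: lerD; first by rewrite mulrC ler_wpM2l.
    by rewrite le_eqVlt; apply/orP; left; apply/eqP; ring.
  have -> : \sum_(e in K) h e * mu = Y * (tau * mu) * (\sum_(e in K) phi (b e)).
    by rewrite mulr_sumr; apply: eq_bigr => e _; rewrite /h; ring.
  have hK1 : 0 <= mu ^+ 2 * #|K|%:R by apply: mulr_ge0 => //; apply: exprn_ge0.
  have hK0 : 0 <= j%:R * (mu ^+ 2 * #|K|%:R) by apply: mulr_ge0.
  have -> : Z%:R * (1 + tau * mu) ^+ j.+1 = Y + Y * (tau * mu).
    by rewrite /Y exprSr; ring.
  rewrite /a -natr1; lra.
have f0 A : 0 <= (nu (C :|: A))%:R :> R by [].
have fmono : set_mono (fun A => (nu (C :|: A))%:R : R).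
  by move=> A B AB; rewrite ler_nat packing_number_mono // setUS.
apply: (le_trans (round_lower a g0 h0)).
apply: (@le_trans _ _ (round (fun A x => budgetEx (fun e => b e - x e) (fun B => (nu (C :|: (A :|: B)))%:R)))); last first.
  by apply: (round_budget k0 w0 hs hqf m hT wn hb fmono f0).
apply: (round_le k0 w0 hs hqf hT wn) => A x hx.
pose c' := (c + (has_pm k [set: V] A && [disjoint C & A]))%N.
have hb' e : b e - x e <= 1 by have := hb e; have /andP[] := hx e; lra.
have hbK' e : e \notin K -> b e - x e = 0.
  move=> eK; rewrite hbK //; have := hx e; rewrite /cst_on (negbTE eK) sub0r.
  by rewrite -eq_le => /eqP <-; rewrite oppr0.
have V0 : (0 < #|V|)%N by rewrite hV muln_gt0 k0 (leq_trans w0).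
have hc' : (c' <= nu (C :|: A))%N.
  rewrite /c'; case: andP => [[hA dA]|_].
    apply: leq_trans (packing_numberU V0 dA); apply: leq_add => //.
    exact: (has_pm_packing_number hA).
  by rewrite addn0 (leq_trans hc) // packing_number_mono // subsetUl.
have hZ' : (c' + j <= Z)%N.
  by rewrite (leq_trans _ hZ) // addnS -addSn leq_add2r /c' -addn1 leq_add2l; case: andP.
have := IH _ (C :|: A) c' hb' hbK' hc' hZ'.
under eq_budgetEx => [? |?] do [over|rewrite -setUA; over].
apply: le_trans; rewrite -/Y.
have sumA : \sum_e (e \in A)%:R = #|A|%:R :> R.
  by rewrite -sum1_card natr_sum [RHS]big_mkcond /=; apply: eq_bigr => e _; case: (e \in A).
have hCA : (#|C :|: A|%:R <= #|C|%:R + #|A|%:R :> R).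
  by rewrite -natrD ler_nat cardsU leq_subr.
(* A round that meets [C] is not counted in [c'], but then the subtracted sum is at least 1. *)
have hc1 : c%:R + hp A - \sum_(e in C) (e \in A)%:R <= c'%:R :> R.
  have sum0 : 0 <= \sum_(e in C) (e \in A)%:R :> R by apply: sumr_ge0.
  rewrite /c' /hp natrD; have [hA|hA] := boolP (has_pm _ _ A) => /=; last by rewrite mulr0n; lra.
  have [dA|] := boolP [disjoint C & A]; first by rewrite /= mulr1n; lra.
  rewrite -setI_eq0 => /set0Pn[e]; rewrite inE => /andP[eC eA].
  rewrite (bigD1 e) //= eA /= mulr1n mulr0n.
  have : 0 <= \sum_(i in C | i != e) (i \in A)%:R :> R by apply: sumr_ge0.
  by lra.
have hphi : \sum_(e in K) phi (b e - x e) <= \sum_(e in K) phi (b e) + \sum_(e in K) phi (b e) * tau * x e.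
  rewrite -big_split; apply: ler_sum => e eK /=.
  have -> : phi (b e) + phi (b e) * tau * x e = phi (b e) * (1 + tau * x e) by ring.
  apply: phiB.
  by have := hx e; rewrite /cst_on eK.
have -> : \sum_e g e * (e \in A)%:R = \sum_(e in C) (e \in A)%:R + j%:R * mu * #|A|%:R.
  rewrite -sumA mulr_sumr [X in X + _]big_mkcond -big_split; apply: eq_bigr => e _ /=.
  by rewrite /g mulrDl; case: (e \in C); rewrite ?mul1r ?mul0r.
have -> : \sum_(e in K) h e * x e = Y * (\sum_(e in K) phi (b e) * tau * x e).
  by rewrite mulr_sumr; apply: eq_bigr => e _; rewrite /h !mulrA.
have := ler_wpM2l Y0 hphi.
have := ler_wpM2l (mulr_ge0 (ler0n R j) mu0) hCA.
rewrite /a; rewrite -/(hp A); lra.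
Qed.

Lemma packing_number_lower (t : nat) (p : R) : 0 <= p <= 1 ->
  t%:R * gam - t%:R ^+ 2 * mu ^+ 2 * 'C(k * n, k)%:R
    - t%:R * (1 + tau * mu) ^+ t * ('C(k * n, k)%:R * phi p) <=
  Ex (cst_on K p) (fun B => (nu B)%:R).
Proof.
move=> /andP[p0 p1].
have cK : #|K| = 'C(k * n, k) by rewrite card_edges_in hT.
have := @iterate_rounds t t (cst_on K p) set0 0%N.
rewrite mulr0n add0r cards0 mulr0n mulr0 subr0 cK.
have -> : \sum_(e in K) phi (cst_on K p e) = 'C(k * n, k)%:R * phi p.
  rewrite (eq_bigr (fun=> phi p)) => [|e eK]; last by rewrite /cst_on eK.
  by rewrite sumr_const cK mulr_natl.
move=> h; apply: le_trans (h _ _ _ _) _ => //.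
- by move=> e; rewrite /cst_on; case: ifP.
- by move=> e; rewrite /cst_on => /negbTE ->.
rewrite /budgetEx; case: forallP => [_|].
  by apply: le_Ex => [e|B]; [apply: cst_on_unit_valued; rewrite p0|rewrite set0U].
by case=> e; rewrite /cst_on; case: ifP.
Qed.

End Iterate.

(** * From the mean to high probability *)

Section Superadditivity.
Variables (R : realFieldType) (V : finType) (K : {set {set V}}).
Hypothesis V0 : (0 < #|V|)%N.
Local Notation Enu p := (Ex (cst_on K (p : R)) (fun H => (packing_number H)%:R)).

(** A random set of density [p + q] is cut by an independent set of density [p / (p + q)]. The parts
    are disjoint, of densities [p] and [q], so their packings combine; their dependence is harmless
    because only means are added. *)
Lemma packing_number_superadditive p q : 0 < p -> 0 <= q -> p + q <= 1 ->
  Enu p + Enu q <= Enu (p + q).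
Proof.
move=> p0 q0 pq.
have r0 : 0 < p + q by lra.
pose u (_ : {set V}) := p / (p + q).
have hu : unit_valued u.
  by move=> e; rewrite /u divr_ge0 ?(ltW p0) ?(ltW r0) //= ler_pdivrMr // mul1r lerDl.
have -> : Enu p = Ex (cst_on K (p + q)) (fun C => Ex u (fun S => (packing_number (C :&: S))%:R)).
  rewrite (Ex_setI _ _ (fun H => (packing_number H)%:R)); apply: eq_Exp => e.
  by rewrite /cst_on /u; case: ifP; rewrite ?mul0r // mulrCA divff ?mulr1 ?lt0r_neq0.
have -> : Enu q = Ex (cst_on K (p + q)) (fun C => Ex u (fun S => (packing_number (C :\: S))%:R)).
  rewrite (Ex_setD _ _ (fun H => (packing_number H)%:R)); apply: eq_Exp => e.
  rewrite /cst_on /u; case: ifP; rewrite ?mul0r // => _.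
  by field; rewrite lt0r_neq0.
rewrite -Ex_add; apply: le_Ex => [|C]; first by apply: cst_on_unit_valued; rewrite ltW.
rewrite -Ex_add -[leRHS](Ex_cst u); apply: le_Ex => // S.
rewrite -natrD ler_nat -{3}(setID C S); apply: packing_numberU => //.
by rewrite -setI_eq0 setIDA setIAC -setIDA setDv setI0.
Qed.

Lemma packing_number_scale (s : nat) p : (0 < s)%N -> 0 < p -> s%:R * p <= 1 ->
  s%:R * Enu p <= Enu (s%:R * p).
Proof.
case: s => // s _ p0; elim: s => [|s IH] hs; first by rewrite !mul1r.
rewrite -natr1 mulrDl mul1r addrC.
have -> : (s.+1%:R + 1) * p = p + s.+1%:R * p by ring.
have h : s.+1%:R * p <= 1.
  by apply: le_trans hs; rewrite ler_pM2r // ler_nat.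
apply: le_trans (packing_number_superadditive p0 _ _) => //.
- by rewrite lerD2l IH.
- by rewrite mulr_ge0 // ltW.
- by move: hs; rewrite -[in X in X -> _]natr1 mulrDl mul1r addrC.
Qed.

Lemma card_variance (p : R) : 0 <= p <= 1 ->
  Ex (cst_on K p) (fun H => (\sum_(e in K) ((e \in H)%:R - p)) ^+ 2) <= #|K|%:R * p.
Proof.
move=> hp.
have -> : Ex (cst_on K p) (fun H => (\sum_(e in K) ((e \in H)%:R - p)) ^+ 2) =
  \sum_(e in K) \sum_(e' in K) Ex (cst_on K p) (fun H => ((e \in H)%:R - p) * ((e' \in H)%:R - p)).
  under [RHS]eq_bigr => e _ do rewrite -Ex_sum.
  rewrite -Ex_sum; apply: eq_Ex => H; rewrite expr2 mulr_suml.
  by apply: eq_bigr => e _; rewrite mulr_sumr.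
have cov e e' : e \in K -> e' \in K ->
    Ex (cst_on K p) (fun H => ((e \in H)%:R - p) * ((e' \in H)%:R - p)) = (e == e')%:R * (p * (1 - p)).
  move=> eK e'K; have [<-|ee] := eqVneq e e'.
    transitivity (Ex (cst_on K p) (fun H => (1 - 2 * p) * (e \in H)%:R + p ^+ 2)).
      by apply: eq_Ex => H; case: (e \in H); rewrite ?mulr1n ?mulr0n; ring.
    by rewrite Ex_add Ex_scale Ex_in Ex_cst /cst_on eK mulr1n; ring.
  transitivity (Ex (cst_on K p) (fun H => (e \in H)%:R * (e' \in H)%:R + (- p) * (e \in H)%:R
       + (- p) * (e' \in H)%:R + p ^+ 2)).
    by apply: eq_Ex => H; ring.
  by rewrite !Ex_add !Ex_scale !Ex_in Ex_in2 // Ex_cst /cst_on eK e'K mulr0n; ring.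
rewrite (eq_bigr (fun=> p * (1 - p))) => [|e eK]; last first.
  rewrite (eq_bigr (fun e' => (e == e')%:R * (p * (1 - p)))) => [|e' e'K]; last exact: cov.
  rewrite (bigD1 e) //= eqxx mul1r big1 ?addr0 // => e' /andP[_].
  by rewrite eq_sym => /negbTE ->; rewrite mul0r.
rewrite sumr_const -[leLHS]mulr_natl ler_wpM2l //; case/andP: hp => p0 p1; nra.
Qed.

End Superadditivity.

(** * The binomial model as a product measure *)

Section BinomPr.
Variables (R : realType) (k N : nat).
Local Notation K := (edges_in k [set: 'I_N]).

Lemma ksubsetsE : ksubsets 'I_N k = K.
Proof. by apply/setP => e; rewrite !inE subsetT. Qed.

Lemma binom_PrE (p : R) (P : pred {set {set 'I_N}}) :
  binom_Pr k p P = Ex (cst_on K p) (fun H => (P H)%:R).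
Proof.
rewrite /binom_Pr ksubsetsE /Ex [RHS](bigID (fun H => (H \in powerset K) && P H)) /=.
rewrite [X in _ = _ + X]big1 ?addr0 => [|H].
  apply: eq_bigr => H /andP[HK ->]; rewrite mulr1 /binom_weight ksubsetsE.
  rewrite /wt [RHS](bigID (mem K)) /= [X in _ = _ * X]big1 ?mulr1.
    by apply: eq_bigr => e eK; rewrite /cst_on eK.
  move=> e eK; rewrite /cst_on (negbTE eK) subr0; case: ifP => //.
  by move: HK; rewrite powersetE => /subsetP h /h; rewrite (negbTE eK).
rewrite negb_and => /orP[|/negbTE ->]; last by rewrite mulr0.
by rewrite powersetE => /subsetPn[e eH eK]; rewrite (@wt_supp _ _ _ _ e) ?mul0r // /cst_on (negbTE eK).
Qed.

Lemma has_edge_disjoint_pmsE (H : {set {set 'I_N}}) (x : R) :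
  has_edge_disjoint_pms H x = (x <= (packing_number H)%:R).
Proof.
apply/existsP/idP => [[F /and3P[h1 h2 h3]]|h].
  apply: le_trans h3 _; rewrite ler_nat; apply: leq_packing_number.
  by rewrite /packing h1.
have [F /andP[h1 h2] hF] := packing_number_witness H.
by exists F; rewrite h1 h2 hF.
Qed.

End BinomPr.

(** * Concentration through the mean deficit *)

Section Transfer.
Variables (R : realType) (k n : nat) (p : R).
Hypotheses (k0 : (0 < k)%N) (n0 : (0 < n)%N) (hp : 0 <= p <= 1).
Local Notation K := (edges_in k [set: 'I_(k * n)]).
Local Notation D := (GRing.one R *+ 'C(k * n - 1, k - 1)).

Lemma bin_degree : ('C(k * n, k) = n * 'C(k * n - 1, k - 1))%N.
Proof.
case: k k0 => // k' _; rewrite !subn1 /=; apply/eqP.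
by rewrite -(eqn_pmul2l (ltn0Sn k')) mulnA -mul_bin_diag.
Qed.

Lemma card_edges_inT : #|K|%:R = n%:R * D :> R.
Proof. by rewrite card_edges_in cardsT card_ord bin_degree natrM. Qed.

(** The positive part makes Markov's inequality applicable. *)
Definition deficit : R :=
  Ex (cst_on K p) (fun H => Num.max (D * p - (packing_number H)%:R) 0).

Lemma deficit_ge0 : 0 <= deficit.
Proof. by apply: Ex_ge0 => [|H]; [apply: cst_on_unit_valued|rewrite le_max lexx orbT]. Qed.

(** Let [y = #|H| / n - D * p], of mean 0 and variance at most [D * p / n]. As
    [packing_number H <= #|H| / n] and [a + y ^+ 2 / a + y >= 0], the positive part is at most [a +
    y ^+ 2 / a + y + D * p - packing_number H]; then take means. *)
Lemma deficit_le (a : R) : 0 < a ->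
  deficit <= a + D * p / (a * n%:R) + D * p - Ex (cst_on K p) (fun H => (packing_number H)%:R).
Proof.
move=> a0; have n0' : 0 < n%:R :> R by rewrite ltr0n.
pose Y (H : {set {set 'I_(k * n)}}) : R := \sum_(e in K) ((e \in H)%:R - p).
have EY : Ex (cst_on K p) Y = 0.
  rewrite /Y Ex_sum big1 // => e eK.
  by rewrite Ex_sub Ex_in Ex_cst /cst_on eK subrr.
have YE (H : {set {set _}}) : H \subset K -> Y H = #|H|%:R - n%:R * (D * p).
  move=> HK; rewrite /Y sumrB sumr_const -[p *+ _]mulr_natl card_edges_inT mulrA; congr (_ - _).
  rewrite -sum1_card natr_sum [RHS]big_mkcond [LHS]big_mkcond /=; apply: eq_bigr => e _.
  by have [/(subsetP HK)->//|_] := boolP (e \in H); case: ifP.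
apply: (@le_trans _ _ (Ex (cst_on K p) (fun H => a + (n%:R ^+ 2 * a)^-1 * Y H ^+ 2 + n%:R^-1 * Y H + D * p
    - (packing_number H)%:R))).
  apply: le_Ex_on => // H HK.
  have hnu : (packing_number H)%:R <= n%:R^-1 * #|H|%:R :> R.
    rewrite mulrC ler_pdivlMr // mulrC -natrM ler_nat.
    by apply: (packing_number_card k0 _ HK); rewrite card_ord.
  have -> : n%:R^-1 * Y H = n%:R^-1 * #|H|%:R - D * p.
    by rewrite YE //; field; rewrite lt0r_neq0.
  have hsq : 0 <= a + (n%:R ^+ 2 * a)^-1 * Y H ^+ 2 + n%:R^-1 * Y H.
    have -> : (n%:R ^+ 2 * a)^-1 * Y H ^+ 2 = a^-1 * (n%:R^-1 * Y H) ^+ 2.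
      by field; rewrite !lt0r_neq0.
    set y := n%:R^-1 * Y H.
    have -> : a + a^-1 * y ^+ 2 + y = a^-1 * ((a + y / 2) ^+ 2 + 3 / 4 * y ^+ 2).
      by field; rewrite lt0r_neq0.
    apply: mulr_ge0; first by rewrite invr_ge0 ltW.
    by have := sqr_ge0 (a + y / 2); have := sqr_ge0 y; lra.
  have hsq' : 0 <= a + (n%:R ^+ 2 * a)^-1 * Y H ^+ 2.
    by rewrite addr_ge0 ?(ltW a0) // mulr_ge0 ?sqr_ge0 // invr_ge0 mulr_ge0 ?sqr_ge0 ?(ltW a0).
  move: hsq; have -> : n%:R^-1 * Y H = n%:R^-1 * #|H|%:R - D * p.
    by rewrite YE //; field; rewrite lt0r_neq0.
  by move=> hsq; rewrite ge_max; apply/andP; split; lra.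
rewrite Ex_sub !Ex_add !Ex_cst !Ex_scale EY mulr0 addr0 lerD2r lerD2r lerD2l.
have hv := card_variance K hp; rewrite card_edges_inT in hv.
apply: (@le_trans _ _ ((n%:R ^+ 2 * a)^-1 * (n%:R * D * p))).
  by rewrite ler_wpM2l // invr_ge0 mulr_ge0 ?sqr_ge0 ?(ltW a0).
rewrite le_eqVlt; apply/orP; left; apply/eqP.
by field; rewrite !lt0r_neq0.
Qed.

Lemma binom_Pr_le1 (P : pred {set {set 'I_(k * n)}}) : binom_Pr k p P <= 1.
Proof.
rewrite binom_PrE -[leRHS](Ex_cst (cst_on K p)); apply: le_Ex => [|H]; first exact: cst_on_unit_valued.
by case: (P H); rewrite ?lexx ?ler01.
Qed.

(** Markov's inequality: on failure the positive part exceeds [eps * (D * p)]. *)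
Lemma binom_Pr_packing (eps : R) : 0 < eps -> 0 < D * p ->
  1 - deficit / (D * p) / eps <=
  binom_Pr k p (fun H : {set {set 'I_(k * n)}} => has_edge_disjoint_pms H ((1 - eps) * D * p)).
Proof.
move=> eps0 Dp0; rewrite binom_PrE lerBlDr -lerBlDl.
rewrite -{1}(Ex_cst (cst_on K p) 1) -Ex_sub -[leRHS]mulrA -invfM /deficit [leRHS]mulrC -Ex_scale.
apply: le_Ex => [|H]; first exact: cst_on_unit_valued.
rewrite has_edge_disjoint_pmsE; case: (leP ((1 - eps) * D * p)) => h.
  rewrite mulr1n subrr; apply: mulr_ge0; last by rewrite le_max lexx orbT.
  by rewrite invr_ge0; apply: mulr_ge0; apply: ltW.
rewrite mulr0n subr0 [leRHS]mulrC ler_pdivlMr ?(mulr_gt0 Dp0 eps0) // mul1r le_max; apply/orP; left.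
rewrite -mulrA in h; nra.
Qed.

End Transfer.

From mathcomp Require Import all_classical all_reals all_analysis.
Import numFieldNormedType.Exports.
Local Open Scope classical_set_scope.
Local Open Scope ring_scope.

Lemma bin_le_exp n m : ('C(n, m) <= n ^ m)%N.
Proof.
have h : (n ^_ m <= n ^ m)%N.
  rewrite ffact_prod -[X in (_ <= _ ^ X)%N]card_ord -prod_nat_const.
  by apply: leq_prod => i _; rewrite leq_subr.
by apply: leq_trans h; rewrite -bin_ffact leq_pmulr ?fact_gt0.
Qed.

(** * Asymptotics *)

Section Asymptotics.
Variable R : realType.
Implicit Types (eps y : R).

(** Follows from [expR y <= 1 / (1 - y)]; it supplies the Chernoff hypothesis [phiB]. *)
Lemma expR_le_quadratic eps y : 0 <= y <= eps -> eps <= 1 / 2 ->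
  expR y <= 1 + (1 + 2 * eps) * y.
Proof.
move=> /andP[y0 ye] he.
have h : 1 - y <= (expR y)^-1 by rewrite -expRN; apply: expR_ge1Dx.
have y1 : 0 < 1 - y by lra.
have h2 : expR y <= (1 - y)^-1.
  by rewrite -[expR y]invrK lef_pV2 // posrE // invr_gt0 expR_gt0.
apply: (le_trans h2).
rewrite -[(1 - y)^-1]mul1r ler_pdivrMr //; nra.
Qed.

Lemma expR_half_le2 : expR (2^-1) <= 2 :> R.
Proof.
have h := expR_ge1Dx (- 2^-1 : R); rewrite expRN in h.
rewrite -[leLHS]invrK -[leRHS]invrK lef_pV2 ?posrE ?invr_gt0 ?expR_gt0 //.
lra.
Qed.

Lemma trunc_log_le_ln n : (0 < n)%N -> (trunc_log 2 n)%:R <= 2 * ln n%:R :> R.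
Proof.
move=> n0; set j := trunc_log 2 n.
have h1 : (2 ^ j <= n)%N by rewrite trunc_logP.
have n0' : 0 < n%:R :> R by rewrite ltr0n.
have h2 : expR (j%:R * 2^-1) <= expR (ln n%:R) :> R.
  rewrite lnK ?posrE // expRM_natl; apply: (@le_trans _ _ (2 ^+ j)).
    by rewrite lerXn2r ?nnegrE ?expR_ge0 // expR_half_le2.
  by rewrite -natrX ler_nat.
rewrite ler_expR in h2; lra.
Qed.

(** * Choice of parameters for [p] between [L] and [2 * L] *)

Section SparseRange.
Variables (k n h : nat) (eps p : R).
Hypotheses (k3 : (3 <= k)%N) (eps0 : 0 < eps) (eps1 : eps <= 1 / 20).
(** With [s = eps / 10] and [h * n] attempts, the failure term [2 ^+ n * (1 - s / 2) ^+ (h * n)] is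
    at most [(1 / 2) ^+ n]. *)
Hypothesis hh : (1 - eps / 10 / 2) ^+ h <= 1 / 4.
Local Notation l := (ln (GRing.one R *+ n)).
Hypotheses (l1 : 3 * 4 ^+ k <= l) (l2 : 3 <= eps * l)
  (l3 : 2 * (6 * 4 ^+ k * k%:R ^+ k) <= eps * l)
  (l4 : (2 * k%:R + 1) * (h%:R + 3 * 4 ^+ k) <= eps ^+ 2 * l)
  (l5 : k%:R <= l)
  (l6 : 4 * l ^+ (5 * k) <= eps * n%:R).
Local Notation L := (l ^+ (5 * k) / n%:R ^+ (k - 1)).
Hypotheses (p1 : p <= 1) (pL : L <= p <= 2 * L).
Local Notation x := (GRing.one R *+ n).
Local Notation D := (GRing.one R *+ 'C(k * n - 1, k - 1)).
Local Notation s := (eps / 10).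

Let lge3 : 3 <= l.
Proof. by apply: le_trans l1; rewrite ler_peMr // exprn_ege1 // ler1n. Qed.

Let n0 : (0 < n)%N.
Proof. by case: n lge3 => // h0; rewrite ln0 in h0; lra. Qed.

Let x0 : 0 < x. Proof. by rewrite ltr0n. Qed.

Let k0 : (0 < k)%N. Proof. exact: leq_trans k3. Qed.

Let xE : expR l = x. Proof. by rewrite lnK ?posrE. Qed.

Let lx : 1 + l <= x. Proof. by rewrite -[leRHS]xE expR_ge1Dx. Qed.

Ltac facts := generalize lge3 eps0 eps1 l2 l3 l6 x0 lx; intros.
Ltac rlra := facts; lra.
Ltac rnra := facts; nra.

Let c2 : R := h%:R + 3 * 4 ^+ k.
(** The power 4 makes the final stage cheap: relative to [1 / D] its mean cost per edge is about
    [w * l ^+ 3 / n], of order [1 / l]. Adding 1 keeps [w] positive. *)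
Let w := (Num.trunc (x / l ^+ 4)).+1.
Local Notation W := (GRing.one R *+ w).

Let l40 : 0 < l ^+ 4. Proof. by rewrite exprn_gt0 //; rlra. Qed.

Let lk a b : (a <= b)%N -> l ^+ a <= l ^+ b.
Proof. by move=> ab; apply: ler_weXn2l => //; rlra. Qed.

Let l4x : l ^+ 4 <= x.
Proof.
apply: (@le_trans _ _ (l ^+ (5 * k))); first by apply: lk; (clear -k3; lia).
have h0 : 0 <= l ^+ (5 * k) by rewrite exprn_ge0 //; rlra.
by have : eps * x <= x; [rewrite ler_piMl //; rlra|rlra].
Qed.

Let Wlow : x / l ^+ 4 <= W.
Proof.
have /truncn_itv/andP[_ /ltW//] : 0 <= x / l ^+ 4.
by rewrite divr_ge0 // ltW.
Qed.

Let Wup : W <= 2 * x / l ^+ 4.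
Proof.
have /truncn_itv/andP[h0 _] : 0 <= x / l ^+ 4 by rewrite divr_ge0 // ltW.
have h1 : 1 <= x / l ^+ 4 by rewrite ler_pdivlMr // mul1r.
by rewrite /w -natr1 -mulrA; rlra.
Qed.

Let wn : (w <= n)%N.
Proof.
rewrite -(ler_nat R); apply: (le_trans Wup); rewrite ler_pdivrMr //.
rewrite mulrC ler_pM2l //; apply: le_trans (lk (_ : 1 <= 4)%N) => //; rewrite expr1; rlra.
Qed.

Let j := (trunc_log 2 n).+1.

Let jl : j%:R <= 3 * l.
Proof. by rewrite /j -natr1; have := trunc_log_le_ln n0; rlra. Qed.

Let wj : (0 < w < 2 ^ j)%N.
Proof. by rewrite /= (leq_ltn_trans wn) // trunc_log_ltn. Qed.

(** The factor [l ^+ 2] makes each halving lose mass at most [1 / l ^+ 2], so the [j <= 3 * l]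
    halvings lose at most [z], of order [1 / l]. *)
Let q1 : R := l ^+ 2 * (4 * 4 ^+ k.-1) / W ^+ k.-1.
Let qf : R := j%:R * q1.

Let W0 : 0 < W. Proof. by rewrite ltr0n. Qed.

Let q10 : 0 < q1.
Proof. by rewrite /q1 divr_gt0 ?exprn_gt0 // !mulr_gt0 ?exprn_gt0 //; rlra. Qed.

Let kE : 4 * 4 ^+ k.-1 = 4 ^+ k :> R.
Proof. by rewrite -exprS prednK. Qed.

Let qfW : qf * W ^+ k.-1 <= 3 * 4 ^+ k * l ^+ 3.
Proof.
rewrite /qf /q1 kE mulrA divfK ?lt0r_neq0 ?exprn_gt0 //.
have -> : 3 * 4 ^+ k * l ^+ 3 = (3 * l) * (l ^+ 2 * 4 ^+ k) by ring.
by rewrite ler_pM2r // mulr_gt0 ?exprn_gt0 //; rlra.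
Qed.

Let P0 : 0 < x ^+ (k - 1). Proof. by rewrite exprn_gt0. Qed.

Let qf_le : qf <= 3 * 4 ^+ k * l ^+ (4 * k) / x ^+ (k - 1).
Proof.
rewrite ler_pdivlMr //.
have h1 : x ^+ k.-1 <= (W * l ^+ 4) ^+ k.-1.
  rewrite lerXn2r ?nnegrE //; last by rewrite -ler_pdivrMr.
  by rewrite mulr_ge0 // ltW.
rewrite subn1; apply: (@le_trans _ _ (qf * (W * l ^+ 4) ^+ k.-1)).
  by rewrite ler_wpM2l // /qf mulr_ge0 // ltW.
rewrite exprMn mulrA; apply: (@le_trans _ _ (3 * 4 ^+ k * l ^+ 3 * (l ^+ 4) ^+ k.-1)).
  by rewrite ler_wpM2r // exprn_ge0 // ltW.
rewrite -exprM -[leLHS]mulrA -exprD ler_wpM2l //.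
by apply: lk; (clear -k3; lia).
Qed.

Let l4k : 3 * 4 ^+ k * l ^+ (4 * k) <= x.
Proof.
apply: (@le_trans _ _ (l ^+ (5 * k))).
  apply: (@le_trans _ _ (l * l ^+ (4 * k))).
    by rewrite ler_wpM2r // exprn_ge0 //; rlra.
  by rewrite -exprS; apply: lk; (clear -k3; lia).
have h0 : 0 <= l ^+ (5 * k) by rewrite exprn_ge0 //; rlra.
by have : eps * x <= x; [rewrite ler_piMl //; rlra|rlra].
Qed.

Let qf1 : 0 <= qf <= 1.
Proof.
rewrite /qf mulr_ge0 ?(ltW q10) //=; apply: le_trans qf_le _.
rewrite ler_pdivrMr // mul1r; apply: (le_trans l4k).
rewrite -[leLHS]expr1; apply: ler_weXn2l; first by rlra.
by (clear -k3; lia).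
Qed.

Let z : R := j%:R / l ^+ 2.

Let z_le : z <= eps.
Proof.
rewrite /z ler_pdivrMr ?exprn_gt0 //; last by rlra.
apply: (le_trans jl); rewrite expr2 mulrA ler_pM2r //; rlra.
Qed.

Let hz (U : {set 'I_(k * n)}) : #|U| = (k * w)%N ->
  1 - z <= Ex (cst_on (edges_in k U) qf) (fun B => (has_pm k U B)%:R).
Proof.
move=> hU; have e1 : q1 * W ^+ k.-1 = l ^+ 2 * (4 * 4 ^+ k.-1).
  by rewrite /q1 divfK // lt0r_neq0 // exprn_gt0.
have f0 : 0 < 4 * 4 ^+ k.-1 :> R by rewrite mulr_gt0 // exprn_gt0.
have l20 : 0 < l ^+ 2 by rewrite exprn_gt0 //; rlra.
have /andP[_ jq] := qf1.
have := has_pm_prob k0 hU wj q10 jq; rewrite e1.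
have -> : 4 * 4 ^+ k.-1 / (l ^+ 2 * (4 * 4 ^+ k.-1)) = (l ^+ 2)^-1.
  by field; rewrite !lt0r_neq0 //; rlra.
apply; rewrite ler_peMl ?(ltW f0) //.
by apply: exprn_ege1; rlra.
Qed.

Let s0 : 0 < s <= 1 / 4. Proof. by apply/andP; split; rlra. Qed.

Let m := (h * n)%N.
Local Notation X := (max_spend k w s qf m).

Let X_le : X <= c2 * l ^+ (4 * k) / x ^+ (k - 1).
Proof.
have -> : c2 * l ^+ (4 * k) / x ^+ (k - 1) =
    h%:R * l ^+ (4 * k) / x ^+ (k - 1) + 3 * 4 ^+ k * l ^+ (4 * k) / x ^+ (k - 1).
  by rewrite /c2; ring.
rewrite /max_spend; apply: lerD; last exact: qf_le.
have C0 : 0 < 'C(k * w, k)%:R :> R by rewrite ltr0n bin_gt0 leq_pmulr.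
have s1' : 0 < 1 - 2 * s by rlra.
have h1 : s / ((1 - 2 * s) * 'C(k * w, k)%:R) <= ('C(k * w, k)%:R)^-1.
  rewrite ler_pdivrMr ?mulr_gt0 // mulrCA mulVf ?lt0r_neq0 //; rlra.
have h2 : ('C(k * w, k)%:R)^-1 <= (W ^+ k)^-1.
  by rewrite lef_pV2 ?posrE ?exprn_gt0 // -natrX ler_nat leq_exp_bin.
have h3 : (W ^+ k)^-1 <= ((x / l ^+ 4) ^+ k)^-1.
  rewrite lef_pV2 ?posrE ?exprn_gt0 ?divr_gt0 // lerXn2r ?nnegrE //.
    by rewrite divr_ge0 // ltW.
apply: (@le_trans _ _ (m%:R * ((x / l ^+ 4) ^+ k)^-1)).
  by rewrite ler_wpM2l //; apply: le_trans (le_trans h2 h3).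
rewrite /m natrM expr_div_n invf_div -exprM le_eqVlt; apply/orP; left; apply/eqP.
have -> : x ^+ k = x ^+ (k - 1) * x by rewrite -exprSr subn1 prednK.
by field; rewrite !lt0r_neq0 // exprn_gt0.
Qed.

Let D0 : 0 < D. Proof. by rewrite ltr0n bin_gt0 leq_sub2r // leq_pmulr. Qed.

Let D_ge : x ^+ (k - 1) <= D.
Proof.
have := leq_exp_bin k n; rewrite (bin_degree n k0).
rewrite -{1}[k]prednK // expnS leq_pmul2l // -subn1 => hD.
by rewrite -natrX ler_nat.
Qed.

Local Notation mu := (@spend_mean R k w n s qf).

(** As ['C(k * n, k) = n * D], the product is [1 / (1 - 2 * s)] plus ['C(k * w, k) * qf / n], and
    the latter is of order [1 / l]. *)
Let mu_le : mu * D <= 1 + eps.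
Proof.
rewrite /spend_mean (bin_degree n k0) natrM invfM mulrA.
rewrite divfK ?lt0r_neq0 // mulrDl mulrAC divff ?lt0r_neq0 // mul1r.
have a1 : (1 - 2 * s)^-1 <= 1 + eps / 2.
  rewrite -[_^-1]mul1r ler_pdivrMr; rnra.
have a2 : 'C(k * w, k)%:R * qf / x <= eps / 2.
  rewrite ler_pdivrMr //.
  have b1 : 'C(k * w, k)%:R <= k%:R ^+ k * W ^+ k :> R.
    by rewrite -exprMn -natrM -natrX ler_nat bin_le_exp.
  have /andP[qf0 _] := qf1.
  apply: le_trans (ler_wpM2r qf0 b1) _.
  have -> : k%:R ^+ k * W ^+ k * qf = k%:R ^+ k * W * (qf * W ^+ k.-1).
    have -> : W ^+ k = W * W ^+ k.-1 by rewrite -exprS prednK.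
    by ring.
  have c0 : 0 <= k%:R ^+ k * W by rewrite mulr_ge0 // exprn_ge0.
  apply: le_trans (ler_wpM2l c0 qfW) _.
  have d0 : 0 <= k%:R ^+ k * (3 * 4 ^+ k * l ^+ 3).
    by rewrite !mulr_ge0 ?exprn_ge0 //; rlra.
  rewrite mulrAC; apply: le_trans (ler_wpM2l d0 Wup) _.
  have -> : k%:R ^+ k * (3 * 4 ^+ k * l ^+ 3) * (2 * x / l ^+ 4) =
      (6 * 4 ^+ k * k%:R ^+ k) / l * x.
    by field; rlra.
  rewrite ler_pM2r // ler_pdivrMr; rlra.
rlra.
Qed.

(** Chosen so that one round moves the exponent by at most [eps], while [th * p] is still of order
    [l ^+ k]: the gap between [l ^+ (5 * k)] in [L] and [l ^+ (4 * k)] in the bound for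
    [max_spend]. *)
Let th : R := eps * x ^+ (k - 1) / (c2 * l ^+ (4 * k)).
Let c20 : 0 < c2. Proof. by rewrite /c2 ltr_wpDl // mulr_gt0 // exprn_gt0. Qed.
Let lk0 : 0 < l ^+ (4 * k). Proof. by rewrite exprn_gt0 //; rlra. Qed.
Let th0 : 0 < th. Proof. by rewrite /th divr_gt0 ?mulr_gt0. Qed.

Let thX : th * X <= eps.
Proof.
apply: le_trans (ler_wpM2l (ltW th0) X_le) _.
rewrite le_eqVlt; apply/orP; left; apply/eqP.
by rewrite /th; field; rewrite !lt0r_neq0.
Qed.

(** Of the left side, [2 * k * l] pays for the union bound over at most [n ^ (2 * k)] edges, and the
    remaining [l] leaves an error of [1 / n]. *)
Let thp : (2 * k%:R + 1) * l <= eps * (th * p).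
Proof.
have /andP[pL1 _] := pL.
apply: (@le_trans _ _ (eps * (th * L))); last by rewrite !ler_pM2l.
have -> : eps * (th * L) = eps ^+ 2 * l ^+ k / c2.
  rewrite /th (_ : l ^+ (5 * k) = l ^+ (4 * k) * l ^+ k); last by rewrite -exprD; congr (_ ^+ _); (clear -k3; lia).
  by field; rewrite !lt0r_neq0.
rewrite ler_pdivlMr // mulrAC.
have lpos : 0 <= l by rlra.
apply: le_trans (ler_wpM2r lpos l4) _.
rewrite -mulrA -expr2 ler_wpM2l ?sqr_ge0 //; apply: lk; (clear -k3; lia).
Qed.

Let tau : R := th * (1 + 2 * eps).
Let phi y : R := expR (- (th * y)).
(** The slack [5 * eps] absorbs the factors [1 + eps] from [mu_le] and [1 + 2 * eps] from [tau], and
    still leaves a margin [eps * p] of budget. *)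
Let t := Num.trunc ((1 - 5 * eps) * (p * D)).

Let p0 : 0 < p.
Proof.
have /andP[pL1 _] := pL; apply: lt_le_trans pL1.
by rewrite divr_gt0 // exprn_gt0 //; rlra.
Qed.

Let pD : l <= p * D.
Proof.
have /andP[pL1 _] := pL.
apply: (@le_trans _ _ (L * x ^+ (k - 1))).
  by rewrite divfK ?lt0r_neq0 // -[leLHS]expr1; apply: lk; (clear -k3; lia).
by apply: ler_pM => //; rewrite ltW // divr_gt0 // exprn_gt0 //; rlra.
Qed.

Let t_le : t%:R <= (1 - 5 * eps) * (p * D).
Proof.
have /truncn_itv/andP[//] : 0 <= (1 - 5 * eps) * (p * D).
by rewrite mulr_ge0 ?mulr_ge0 ?ltW //; rlra.
Qed.

Let t_ge : (1 - 6 * eps) * (p * D) <= t%:R.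
Proof.
have /truncn_itv/andP[_] : 0 <= (1 - 5 * eps) * (p * D).
  by rewrite mulr_ge0 ?mulr_ge0 ?ltW //; rlra.
rewrite -/t -natr1 => /ltW h1; have h2 := ler_wpM2l (ltW eps0) pD; rlra.
Qed.

Let mu0 : 0 <= mu. Proof. by apply: spend_mean_ge0 => //; case/andP: qf1. Qed.

(* The union bound over all edges for the Chernoff estimate, whose exponent is of
   order [l ^+ k]. *)
Let error_budget : (1 + tau * mu) ^+ t * ('C(k * n, k)%:R * phi p) <= eps.
Proof.
have tm0 : 0 <= tau * mu.
  by rewrite mulr_ge0 // /tau mulr_ge0 ?(ltW th0) //; rlra.
have e1 : (1 + tau * mu) ^+ t <= expR (t%:R * (tau * mu)).
  rewrite expRM_natl lerXn2r ?nnegrE ?expR_ge0 ?expR_ge1Dx //; rlra.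
have e2 : t%:R * (tau * mu) <= (1 - eps) * (th * p).
  apply: (@le_trans _ _ ((1 - 5 * eps) * (p * D) * (tau * mu))).
    by rewrite ler_wpM2r.
  have -> : (1 - 5 * eps) * (p * D) * (tau * mu) =
     (1 - 5 * eps) * (1 + 2 * eps) * (mu * D) * (th * p) by rewrite /tau; ring.
  rewrite ler_pM2r ?(mulr_gt0 th0 p0) //.
  apply: (@le_trans _ _ ((1 - 5 * eps) * (1 + 2 * eps) * (1 + eps))); last by rnra.
  by rewrite ler_wpM2l // mulr_ge0; rlra.
have e3 : 'C(k * n, k)%:R <= expR (2 * k%:R * l).
  apply: (@le_trans _ _ (x ^+ (2 * k))).
    apply: (@le_trans _ _ ((k * n) ^ k)%:R); first by rewrite ler_nat bin_le_exp.
    rewrite natrX natrM exprM lerXn2r ?nnegrE ?sqr_ge0 ?mulr_ge0 // expr2 ler_wpM2r //.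
    have := l5; rlra.
  by rewrite -{1}xE -expRM_natl natrM.
have C0 : 0 <= 'C(k * n, k)%:R :> R by [].
apply: (@le_trans _ _ (expR ((1 - eps) * (th * p)) * (expR (2 * k%:R * l) * phi p))).
  apply: ler_pM => //; first by rewrite exprn_ge0 //; rlra.
  - by rewrite mulr_ge0 // expR_ge0.
  - by apply: (le_trans e1); rewrite ler_expR.
  by rewrite ler_wpM2r // expR_ge0.
rewrite /phi -!expRD.
apply: (@le_trans _ _ (expR (- l))); first by rewrite ler_expR; have := thp; rlra.
rewrite expRN xE -[_^-1]mul1r ler_pdivrMr //.
have h1 := ler_wpM2l (ltW eps0) lx; rlra.
Qed.

(* The number of pairs of rounds sharing an edge is about t ^ 2 / n ^ (k - 2); this is
   where [3 <= k] is needed. *)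
Let error_overlap : t%:R * mu ^+ 2 * 'C(k * n, k)%:R <= eps.
Proof.
rewrite (bin_degree n k0) natrM.
have -> : t%:R * mu ^+ 2 * (x * D) = (mu * D) ^+ 2 * (t%:R / D * x).
  by field; rewrite lt0r_neq0.
have h1 : (mu * D) ^+ 2 <= 2.
  have : (mu * D) ^+ 2 <= (1 + eps) ^+ 2.
    by rewrite lerXn2r ?nnegrE ?(mulr_ge0 mu0 (ltW D0)) //; rlra.
  move=> /le_trans; apply; rnra.
have h2 : t%:R / D <= p.
  rewrite ler_pdivrMr //; apply: (le_trans t_le).
  by rewrite ler_piMl ?mulr_ge0 ?ltW //; rlra.
have /andP[_ pL2] := pL.
have h3 : p * x <= 2 * l ^+ (5 * k) / x.
  apply: (@le_trans _ _ (2 * L * x)); first by rewrite ler_pM2r.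
  have -> : x ^+ (k - 1) = x ^+ (k - 3) * x * x by rewrite -!exprSr; congr (_ ^+ _); (clear -k3; lia).
  have x1 : 1 <= x ^+ (k - 3) by rewrite exprn_ege1 //; rlra.
  have -> : 2 * (l ^+ (5 * k) / (x ^+ (k - 3) * x * x)) * x = 2 * l ^+ (5 * k) / x / x ^+ (k - 3).
    by field; rewrite !lt0r_neq0 // exprn_gt0.
  rewrite ler_pdivrMr ?exprn_gt0 // ler_peMr //; apply: divr_ge0; last exact: ltW.
  by rewrite mulr_ge0 // exprn_ge0 //; rlra.
have h4 : 2 * l ^+ (5 * k) / x <= eps / 2.
  by rewrite ler_pdivrMr //; rlra.
have h5 : t%:R / D * x <= eps / 2.
  by apply: (@le_trans _ _ (p * x)); [rewrite ler_pM2r|rlra].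
have h6 : 0 <= t%:R / D * x by rewrite !mulr_ge0 ?invr_ge0 ?(ltW D0).
apply: (@le_trans _ _ (2 * (t%:R / D * x))); first by rewrite ler_wpM2r.
rlra.
Qed.

Let success : 1 - 2 * eps <= @round_success R n m s z.
Proof.
rewrite /round_success /m.
have h1 : 2 ^+ n * (1 - s / 2) ^+ (h * n) <= eps.
  rewrite exprM -exprMn; apply: (@le_trans _ _ ((1 / 2) ^+ n)).
    rewrite lerXn2r ?nnegrE //.
      by rewrite mulr_ge0 // exprn_ge0 //; rlra.
    have := hh; rlra.
  rewrite expr_div_n expr1n ler_pdivrMr ?exprn_gt0 //.
  have h2 : x <= 2 ^+ n by rewrite -natrX ler_nat ltnW // ltn_expl.
  have h3 := ler_wpM2l (ltW eps0) (le_trans lx h2); rlra.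
have := z_le; rlra.
Qed.

Lemma dense_packing :
  (1 - 10 * eps) * (D * p) <=
  Ex (cst_on (edges_in k [set: 'I_(k * n)]) p) (fun H => (packing_number H)%:R).
Proof.
have hV : #|'I_(k * n)| = (k * n)%N by rewrite card_ord.
have tau0 : 0 <= tau by rewrite mulr_ge0 ?(ltW th0) //; rlra.
have phi0 y : 0 <= phi y by rewrite expR_ge0.
have phi1 y : y < 0 -> 1 <= phi y.
  by move=> y0; rewrite -expR0 ler_expR oppr_ge0 pmulr_rle0 // ltW.
have phiB (y v : R) : 0 <= v <= X -> phi (y - v) <= phi y * (1 + tau * v).
  move=> /andP[v0 vX]; rewrite /phi mulrBr opprB addrC expRD ler_wpM2l ?expR_ge0 //.
  have -> : tau * v = (1 + 2 * eps) * (th * v) by rewrite /tau; ring.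
  apply: expR_le_quadratic; last by rlra.
  rewrite mulr_ge0 ?(ltW th0) //=; apply: le_trans thX.
  by rewrite ler_pM2l.
have zge0 : 0 <= z by rewrite divr_ge0 // exprn_ge0 //; rlra.
have pp : 0 <= p <= 1 by rewrite ltW.
have := packing_number_lower k0 (ltn0Sn _) s0 qf1 hV wn zge0 hz tau0 phi0 phi1 phiB t pp.
apply: le_trans.
have -> : t%:R * round_success n m s z - t%:R ^+ 2 * mu ^+ 2 * 'C(k * n, k)%:R -
    t%:R * (1 + tau * mu) ^+ t * ('C(k * n, k)%:R * phi p) =
  t%:R * (round_success n m s z - t%:R * mu ^+ 2 * 'C(k * n, k)%:R -
     (1 + tau * mu) ^+ t * ('C(k * n, k)%:R * phi p)) by ring.
(* A round fails with probability at most [2 * eps], and the two error terms cost [eps] each. *)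
apply: (@le_trans _ _ (t%:R * (1 - 4 * eps))); last first.
  by rewrite ler_wpM2l //; have := success; have := error_overlap; have := error_budget; rlra.
apply: (@le_trans _ _ ((1 - 6 * eps) * (p * D) * (1 - 4 * eps))); last first.
  by rewrite ler_wpM2r //; rlra.
have : 0 <= p * D by rewrite mulr_ge0 ?ltW.
rewrite [D * p]mulrC; rnra.
Qed.

End SparseRange.
End Asymptotics.

(** * Large [n], and larger [p] by superadditivity *)

Section Limits.
Variable R : realType.

Lemma near_ln_ge (A : R) : \forall n \near \oo, A <= ln n%:R.
Proof.
near=> n; rewrite -(@ler_expR R); have hn : expR A <= n%:R by near: n; apply: nbhs_infty_ger.
by rewrite lnK // posrE (lt_le_trans (expR_gt0 A)).
Unshelve. all: by end_near. Qed.

(** Raising [expR (l / (a + 1)) >= l / (a + 1)] to the power [a + 1] bounds [n] below by a multiple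
    of [l ^+ a.+1]; the extra factor [l] absorbs the constants. *)
Lemma near_expr_ln_le (a : nat) (c : R) : 0 < c ->
  \forall n \near \oo, ln n%:R ^+ a <= c * n%:R.
Proof.
move=> c0; near=> n.
have hl : a.+1%:R ^+ a.+1 / c <= ln (GRing.one R *+ n) by near: n; apply: near_ln_ge.
have hn : (0 < n)%N by near: n; apply: nbhs_infty_gt.
set l := ln _ in hl *.
have b0 : 0 < a.+1%:R ^+ a.+1 :> R by rewrite exprn_gt0.
have l0 : 0 < l by apply: lt_le_trans hl; rewrite divr_gt0.
have h1 : (l / a.+1%:R) ^+ a.+1 <= n%:R.
  rewrite -[leRHS](@lnK R) ?posrE ?ltr0n // -/l.
  rewrite -{2}[l](@divfK _ a.+1%:R) // expRM_natr lerXn2r ?nnegrE ?expR_ge0 ?divr_ge0 ?(ltW l0) //.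
  by apply: le_trans (expR_ge1Dx _); rewrite lerDr.
rewrite expr_div_n ler_pdivrMr // exprS in h1.
rewrite -(ler_pM2l l0); apply: (le_trans h1).
have h2 : a.+1%:R ^+ a.+1 <= l * c by rewrite -ler_pdivrMr.
by rewrite mulrA [leLHS]mulrC ler_wpM2r.
Unshelve. all: by end_near. Qed.

Lemma exists_expr_le (y : R) : 0 < y <= 1 -> exists h, (1 - y) ^+ h <= 1 / 4.
Proof.
move=> /andP[y0 y1]; exists (Num.trunc (3 / y)).+1; set h := _.+1.
have hy : 3 <= h%:R * y.
  rewrite -ler_pdivrMr //; have /truncn_itv/andP[_ /ltW//] : 0 <= 3 / y.
  by rewrite divr_ge0 // ltW.
apply: (@le_trans _ _ (expR (- (h%:R * y)))).
  rewrite -mulrN expRM_natl lerXn2r ?nnegrE ?expR_ge0 //; first by lra.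
  by apply: expR_ge1Dx.
rewrite expRN mul1r lef_pV2 ?posrE ?expR_gt0 //.
by apply: le_trans (expR_ge1Dx _); lra.
Qed.

Variable k : nat.
Hypothesis k3 : (3 <= k)%N.
Local Notation L n := (ln n%:R ^+ (5 * k) / n%:R ^+ (k - 1) : R).
Local Notation D n := (GRing.one R *+ 'C(k * n - 1, k - 1)).

(** [p] is divided into [s] equal parts between [L n] and [2 * L n], where [dense_packing] applies,
    and [packing_number_scale] adds them up. The largeness conditions concern [n] alone, hence the
    uniformity in [p]. *)
Lemma near_packing_number_mean (eps : R) : 0 < eps -> eps <= 1 / 20 ->
  \forall n \near \oo, forall p : R, L n <= p -> p <= 1 ->
  (1 - 10 * eps) * (D n * p) <=
  Ex (cst_on (edges_in k [set: 'I_(k * n)]%SET) p) (fun H => (packing_number H)%:R).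
Proof.
move=> e0 e1.
have [h hh] : exists h, (1 - eps / 10 / 2) ^+ h <= 1 / 4.
  by apply: exists_expr_le; lra.
near=> n => p pL p1.
have n0 : (0 < n)%N by near: n; apply: nbhs_infty_gt.
have lge1 : 1 <= ln (GRing.one R *+ n) by near: n; apply: near_ln_ge.
have L0 : 0 < L n by rewrite divr_gt0 // exprn_gt0 ?ltr0n //; lra.
pose s := Num.trunc (p / L n).
have pL1 : 1 <= p / L n by rewrite ler_pdivlMr // mul1r.
have /truncn_itv/andP[s1 s2] : 0 <= p / L n by lra.
rewrite -/s in s1 s2.
have s0 : (0 < s)%N by rewrite /s truncn_gt0.
have s0' : 0 < s%:R :> R by rewrite ltr0n.
have s1' : 1 <= s%:R :> R by rewrite ler1n.
have p0 : 0 < p by apply: lt_le_trans pL.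
have k0 : (0 < k)%N by apply: leq_trans k3.
have hp0 : L n <= p / s%:R <= 2 * L n.
  rewrite ler_pdivlMr // mulrC -ler_pdivlMr // s1 /= ler_pdivrMr //.
  rewrite mulrAC -ler_pdivrMr //; move: s2; rewrite -natr1; lra.
have hp1 : p / s%:R <= 1 by rewrite ler_pdivrMr // mul1r; apply: le_trans s1'.
have main := @dense_packing R k n h eps (p / s%:R) k3 e0 e1 hh _ _ _ _ _ _ hp1 hp0.
have V0 : (0 < #|'I_(k * n)|)%N by rewrite card_ord muln_gt0 k0.
have scaled := packing_number_scale (edges_in k [set: 'I_(k * n)]%SET) V0 s0
  (divr_gt0 p0 s0').
have sp : s%:R * (p / s%:R) = p by rewrite mulrC divfK // lt0r_neq0.
rewrite sp in scaled.
apply: le_trans (scaled p1).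
have -> : (1 - 10 * eps) * (D n * p) = s%:R * ((1 - 10 * eps) * (D n * (p / s%:R))).
  by field; rewrite lt0r_neq0.
rewrite ler_pM2l //; apply: main.
- by near: n; apply: near_ln_ge.
- rewrite [leRHS]mulrC -ler_pdivrMr //; by near: n; apply: near_ln_ge.
- rewrite [leRHS]mulrC -ler_pdivrMr //; by near: n; apply: near_ln_ge.
- rewrite [leRHS]mulrC -ler_pdivrMr ?exprn_gt0 //; by near: n; apply: near_ln_ge.
- by near: n; apply: near_ln_ge.
- rewrite mulrC -ler_pdivlMr // mulrAC; near: n; apply: near_expr_ln_le.
  by rewrite divr_gt0.
Unshelve. all: by end_near. Qed.

Lemma near_deficit (eps : R) : 0 < eps -> eps <= 1 / 20 ->
  \forall n \near \oo, forall p : R, L n <= p -> p <= 1 ->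
  0 < D n * p /\ deficit k n p <= 12 * eps * (D n * p).
Proof.
move=> e0 e1; near=> n => p pL p1.
have n0 : (0 < n)%N by near: n; apply: nbhs_infty_gt.
have n0' : 0 < n%:R :> R by rewrite ltr0n.
have lge1 : 1 <= ln (GRing.one R *+ n) by near: n; apply: near_ln_ge.
have lge : eps^-1 <= ln (GRing.one R *+ n) by near: n; apply: near_ln_ge.
have nge : eps^-1 <= n%:R by near: n; apply: nbhs_infty_ger.
have k0 : (0 < k)%N by apply: leq_trans k3.
have P0 : 0 < n%:R ^+ (k - 1) :> R by rewrite exprn_gt0.
have L0 : 0 < L n by rewrite divr_gt0 // exprn_gt0 //; lra.
have p0 : 0 < p by apply: lt_le_trans pL.
have D_ge : n%:R ^+ (k - 1) <= D n.
  have := leq_exp_bin k n; rewrite (bin_degree n k0).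
  rewrite -{1}[k]prednK // expnS leq_pmul2l // -subn1 => hD.
  by rewrite -natrX ler_nat.
have Dp : eps^-1 <= D n * p.
  apply: (le_trans lge); apply: (@le_trans _ _ (n%:R ^+ (k - 1) * L n)).
    rewrite mulrC divfK ?lt0r_neq0 // -[leLHS]expr1; apply: ler_weXn2l => //.
    by rewrite muln_gt0.
  by apply: ler_pM => //; apply: ltW.
have Dp0 : 0 < D n * p by apply: lt_le_trans Dp; rewrite invr_gt0.
split => //.
have mean : (1 - 10 * eps) * (D n * p) <=
  Ex (cst_on (edges_in k [set: 'I_(k * n)]%SET) p) (fun H => (packing_number H)%:R).
  by move: p pL p1 {p0 Dp Dp0}; near: n; apply: near_packing_number_mean.
have pp : 0 <= p <= 1 by rewrite ltW.
have a0 : 0 < eps * (D n * p) by rewrite mulr_gt0.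
apply: (le_trans (deficit_le k0 n0 pp a0)).
(* With [a = eps * (D n * p)] in [deficit_le], the constant 12 is 10 from the mean, 1 from [a] and 1
   from this variance term. *)
have h1 : D n * p / (eps * (D n * p) * n%:R) <= eps * (D n * p).
  have -> : D n * p / (eps * (D n * p) * n%:R) = (eps * n%:R)^-1.
    by field; rewrite !lt0r_neq0 //; move: Dp0; rewrite pmulr_lgt0.
  apply: (@le_trans _ _ 1).
    by rewrite invf_le1 ?mulr_gt0 // mulrC -ler_pdivrMr // mul1r.
  by rewrite mulrC -ler_pdivrMr // mul1r.
lra.
Unshelve. all: by end_near. Qed.

End Limits.

Unset Implicit Arguments.

Theorem theorem1 (R : realType) (k : nat) (hk : (3 <= k)%N) (p : nat -> R)
    (hp01 : forall n : nat, 0 <= p n <= 1)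
    (hp : \forall n \near \oo, ln n%:R ^+ (5 * k) / n%:R ^+ (k - 1) <= p n) :
  exists eps : nat -> R,
    eps n @[n --> \oo] --> (0 : R) /\
    binom_Pr k (p n)
      (fun H : {set {set 'I_(k * n)}} =>
         has_edge_disjoint_pms H
           ((1 - eps n) * 'C(k * n - 1, k - 1)%:R * p n))
      @[n --> \oo] --> (1 : R).
Proof.
have k0 : (0 < k)%N by apply: leq_trans hk.
pose D n : R := 'C(k * n - 1, k - 1)%:R.
(* Taking [eps] as the square root of [r] balances the two errors: Markov's bound is at most
   [r / eps = eps]. The summand [1 / (n + 1)] keeps [eps n] positive. *)
pose r n := deficit k n (p n) / (D n * p n) + n.+1%:R^-1.
pose eps n := Num.sqrt (r n).
have r0 n : 0 < r n.
  apply: ltr_wpDl; last by rewrite invr_gt0.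
  have /andP[p0 _] := hp01 n.
  by rewrite divr_ge0 ?mulr_ge0 // deficit_ge0.
have eps_small (e : R) : 0 < e -> \forall n \near \oo, eps n <= e.
  (* Gives [12 * d <= e ^+ 2 / 2]; the other half of [e ^+ 2] is for [1 / (n + 1)]. *)
  move=> e0; pose d := Num.min (1 / 20) (e ^+ 2 / 24).
  have d0 : 0 < d by rewrite lt_min !divr_gt0 ?exprn_gt0.
  have d1 : d <= 1 / 20 by rewrite ge_min lexx.
  have d2 : d <= e ^+ 2 / 24 by rewrite ge_min lexx orbT.
  near=> n.
  have pL : ln n%:R ^+ (5 * k) / n%:R ^+ (k - 1) <= p n by near: n.
  have /andP[_ p1] := hp01 n.
  have [Dp0 def] : 0 < D n * p n /\ deficit k n (p n) <= 12 * d * (D n * p n).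
    by move: (p n) pL p1; near: n; apply: near_deficit.
  have n2 : 2 / e ^+ 2 <= n%:R by near: n; apply: nbhs_infty_ger.
  rewrite /eps -[e in leRHS]ger0_norm ?(ltW e0) // -sqrtr_sqr ler_wsqrtr //.
  have h1 : deficit k n (p n) / (D n * p n) <= 12 * d by rewrite ler_pdivrMr.
  have h2 : n.+1%:R^-1 <= e ^+ 2 / 2.
    have -> : e ^+ 2 / 2 = (2 / e ^+ 2)^-1 by rewrite invf_div.
    rewrite lef_pV2 ?posrE ?divr_gt0 ?exprn_gt0 //; apply: (le_trans n2).
    by rewrite ler_nat.
  apply: le_trans (lerD h1 h2) _; lra.
exists eps; split.
  apply/cvgrPdist_le => e e0; near=> n.
  rewrite sub0r normrN ger0_norm ?sqrtr_ge0 //.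
  by near: n; apply: eps_small.
apply/cvgrPdist_le => e e0; near=> n.
have pL : ln n%:R ^+ (5 * k) / n%:R ^+ (k - 1) <= p n by near: n.
have hpn := hp01 n; have /andP[_ p1] := hpn.
have n0 : (0 < n)%N by near: n; apply: nbhs_infty_gt.
have Dp0 : 0 < D n * p n.
  suff [] : 0 < D n * p n /\ deficit k n (p n) <= 12 * (1 / 20) * (D n * p n) by [].
  by move: (p n) pL p1 {hpn}; near: n; apply: near_deficit.
have en : eps n <= e by near: n; apply: eps_small.
have e0n : 0 < eps n by rewrite sqrtr_gt0.
rewrite ger0_norm ?subr_ge0; last exact: binom_Pr_le1.
apply: le_trans en; rewrite lerBlDr -lerBlDl.
apply: le_trans (binom_Pr_packing hpn e0n Dp0).
rewrite lerD2l lerN2 ler_pdivrMr // -expr2 sqr_sqrtr ?(ltW (r0 n)) //.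
by rewrite /r lerDl invr_ge0.
Unshelve. all: by end_near. Qed.
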